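(* Let $\mathcal{Z}\subset\mathbb{R}^d$ be a sample space, $P$ a probability distribution on $\mathcal{Z}$, $z_1,\dots,z_n$ iid samples from $P$ with empirical distribution $\hat P$, $\mathcal{F}$ a function class, $\ell:\mathcal{F}\times\mathcal{Z}\to\mathbb{R}$ a loss function, and $f^*\in\arg\min_{f\in\mathcal{F}}\mathbb{E}_P[\ell(f,z)]$. Suppose that $P$ is a discrete distribution supported on $m$ points $\zeta_1,\dots,\zeta_m$, with $\mathbb{P}[z=\zeta_i]=p_i$, and that (i) $p_{\min}=\min_{1\le i\le m}p_i>0$; (ii) $\|\ell(f^*,\cdot)\|_\infty<+\infty$. Then for all $0<\delta<1$, if the ball size is chosen as $\eta=\frac1n\big(m+2\log(4/\delta)+2\sqrt{m\log(4/\delta)}\big)$, then for all $n\ge\frac{10^6m^2}{p_{\min}^3\delta^2}$ the $\chi^2$-divergence DRO solution $$f^*_{\chi^2\text{-dro}}\in\arg\min_{f\in\mathcal{F}}\ \max_{Q:\,D_{\chi^2}(Q\|\hat P)\le\eta}\mathbb{E}_Q[\ell(f,z)]$$ satisfies $$\mathbb{E}_P[\ell(f^*_{\chi^2\text{-dro}},z)]-\mathbb{E}_P[\ell(f^*,z)]\le\|\ell(f^*,\cdot)\|_\infty\Big\{\frac{1}{\sqrt n}\sqrt{m+2\log(4/\delta)+2\sqrt{m\log(4/\delta)}}+\sqrt{\frac{2\log(2/\delta)}{n}}\Big\}$$ with probability at least $1-\delta$.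
   Context: The probability is over the samples $z_1,\dots,z_n$; $\mathbb{E}_Q[\ell(f,z)]$ is the expectation over $z\sim Q$ with $f$ held fixed (in particular $\mathbb{E}_P[\ell(f^*_{\chi^2\text{-dro}},z)]$ is random through the data-dependent $f^*_{\chi^2\text{-dro}}$). The empirical distribution is $\hat P=\frac1n\sum_{i=1}^n\delta_{z_i}$. For probability distributions $Q_1\ll Q_2$ on a space $\Omega$, the $\chi^2$-divergence of $Q_1$ from $Q_2$ is $$D_{\chi^2}(Q_1\|Q_2)=\int_\Omega\Big(\frac{\mathrm{d}Q_1}{\mathrm{d}Q_2}-1\Big)^2\Big/\Big(\frac{\mathrm{d}Q_1}{\mathrm{d}Q_2}\Big)\,\mathrm{d}Q_2,$$ where the integrand is $+\infty$ where $\mathrm{d}Q_1/\mathrm{d}Q_2=0$; the ball $\{Q:D_{\chi^2}(Q\|\hat P)\le\eta\}$ contains only distributions $Q$ on $\mathcal{Z}$ with $Q\ll\hat P$. $\|\cdot\|_\infty$ is the supremum norm on $\mathcal{Z}$. It is implicitly assumed that $f^*$ and $f^*_{\chi^2\text{-dro}}$ exist, that the expectations and maxima appearing are well defined, and that the relevant events are measurable. *)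

(* Defs.v *)
From HB Require Import structures.
From mathcomp Require Import all_boot all_order all_algebra.
From mathcomp Require Import all_classical all_reals all_analysis.

Set Implicit Arguments.
Unset Strict Implicit.
Unset Printing Implicit Defensive.

Import Order.TTheory GRing.Theory Num.Theory.
Import numFieldNormedType.Exports.

Local Open Scope classical_set_scope.
Local Open Scope ring_scope.
Local Open Scope ereal_scope.
Local Open Scope charge_scope.

(* R^d with its Borel sigma-algebra. *)
Definition Rvec (R : realType) (d : nat) : measurableType _ :=
  g_sigma_algebraType (@open 'rV[R]_d).

Definition mutually_independent d1 d2 (Omega : measurableType d1)
    (T : measurableType d2) (R : realType) (Pr : probability Omega R)
    (n : nat) (X : 'I_n -> {RV Pr >-> T}) : Prop :=
  forall (J : {set 'I_n}) (A : 'I_n -> set T),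
    (forall i, measurable (A i)) ->
    Pr (\bigcap_(i in [set` J]) (X i @^-1` A i)) =
    \prod_(i in J) Pr (X i @^-1` A i).

Definition iid_sample d1 d2 (Omega : measurableType d1)
    (T : measurableType d2) (R : realType) (Pr : probability Omega R)
    (n : nat) (X : 'I_n -> {RV Pr >-> T}) (P : probability T R) : Prop :=
  mutually_independent X /\
  (forall i A, measurable A -> distribution Pr (X i) A = P A).

Section empirical.
Context dT (T : measurableType dT) (R : realType) (n : nat) (z : 'I_n -> T).

(* The zero measure when n = 0. *)
Definition empirical (A : set T) : \bar R :=
  (n%:R^-1)%:E * \sum_(i < n) \d_(z i) A.

Let atom (k : nat) : T := if insub k is Some i then z i else point.

Let invn_ge0 : (0 <= n%:R^-1 :> R)%R. Proof. by rewrite invr_ge0. Qed.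

Let empiricalE :
  empirical = mscale (NngNum invn_ge0) (msum (fun k => \d_(atom k)) n).
Proof.
apply/funext => A; rewrite /empirical /mscale /msum; congr (_ * _).
by apply: eq_bigr => i _; rewrite /atom valK.
Qed.

Let empirical0 : empirical set0 = 0.
Proof. by rewrite empiricalE measure0. Qed.

Let empirical_ge0 A : 0 <= empirical A.
Proof. by rewrite empiricalE measure_ge0. Qed.

Let empirical_sigma_additive : semi_sigma_additive empirical.
Proof. by rewrite empiricalE; exact: measure_semi_sigma_additive. Qed.

HB.instance Definition _ := isMeasure.Build _ _ _ empirical
  empirical0 empirical_ge0 empirical_sigma_additive.

Let empirical_fin : fin_num_fun empirical.
Proof.
move=> A mA; rewrite /empirical fin_numM// sum_fin_num.
by apply/allP => x /mapP[i _ ->].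
Qed.

HB.instance Definition _ := Measure_isFinite.Build _ _ _ empirical
  empirical_fin.

End empirical.

Section chi2.
Context dT (T : measurableType dT) (R : realType).

Definition chi2_integrand (r : R) : \bar R :=
  if r == 0%R then +oo else ((r - 1) ^+ 2 / r)%:E.

(* The integrand is divided by r = dQ1/dQ2, so on atoms this is the sum of
   (q1 - q2)^2 / q1 and not the more usual sum of (q1 - q2)^2 / q2.
   Meaningful for Q1 `<< Q2 only: otherwise the library's derivative is a
   dummy constant. *)
Definition chi2_div (Q1 : probability T R)
    (Q2 : {finite_measure set T -> \bar R}) : \bar R :=
  \int[Q2]_x
    chi2_integrand (fine (('d (charge_of_finite_measure Q1) '/d Q2) x)).

Definition chi2_ball (mu : {finite_measure set T -> \bar R}) (eta : R) :
    set (probability T R) :=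
  [set Q : probability T R | Q `<< mu /\ chi2_div Q mu <= eta%:E].

(* When mu is an empirical distribution the supremum is a maximum: the ball is
   then a compact set of weights on finitely many atoms. *)
Definition worst_case_risk (mu : {finite_measure set T -> \bar R}) (eta : R)
    (loss : T -> R) : \bar R :=
  ereal_sup ((fun Q : probability T R => 'E_Q[loss]) @` chi2_ball mu eta).

End chi2.

Definition is_argmin (R : realType) (F : Type) (risk : F -> \bar R) (f : F) :
    Prop :=
  forall g, risk f <= risk g.

(* Valued in \bar R, so that finiteness is a genuine condition. *)
Definition sup_norm (R : realType) (T : Type) (Z : set T) (g : T -> R) :
    \bar R :=
  ereal_sup [set `|g x|%:E | x in Z].

(* The default value 1 of the minimum is harmless, since probabilities are at
   most 1. *)
Definition min_prob (R : realType) (m : nat) (p : 'I_m -> R) : R :=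
  \big[Num.min/1%R]_(i < m) p i.

Definition is_discrete dT (T : measurableType dT) (R : realType)
    (P : probability T R) (m : nat) (zeta : 'I_m -> T) (p : 'I_m -> R) : Prop :=
  [/\ injective zeta,
      forall i, P [set zeta i] = (p i)%:E &
      P (range zeta) = 1].

(* Main.v *)
Require Import Defs.
From mathcomp Require Import all_boot all_order all_algebra.
From mathcomp Require Import all_classical all_reals all_analysis.
From mathcomp Require Import measurable_realfun ring lra.
Import Order.TTheory GRing.Theory Num.Theory.
Import numFieldNormedType.Exports.
Local Open Scope classical_set_scope.
Local Open Scope ring_scope.

Set Implicit Arguments.
Unset Strict Implicit.
Unset Printing Implicit Defensive.

(** Write u for the vector of empirical frequencies of the atoms,
    eta = kappa / n for the size of the ball and L for the supremum norm of the
    loss of fstar.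

    Deterministic part.  On atoms the divergence of Q from the empirical
    distribution is sum_j (q_j - u_j)^2 / q_j.  Hence P lies in the ball as soon
    as Pearson's statistic n * sum_j (p_j - u_j)^2 / p_j is at most kappa
    ([true_in_ball]), and then the P-risk of fdro is at most its worst-case
    risk, which is at most the worst-case risk of fstar.  By the Cauchy-Schwarz
    inequality every Q in the ball is at l1 distance at most sqrt eta from the
    empirical distribution ([sum_abs_le_sqrt]), so the worst-case risk of
    fstar is at most its empirical risk plus L * sqrt eta
    ([ball_expectation_le]).  It remains to compare the empirical and the true
    risk of the single function fstar.  Altogether the bound holds at every
    sample point where Pearson's statistic is at most kappa and the empirical
    risk of fstar exceeds its true risk by at most L * sqrt (2 ln (2/delta) / n)
    ([dro_excess_risk_le]).

    Probabilistic part.  Both events are tail events of sums of iid increments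
    with finitely many values.  If a potential U_k(w) satisfies
    E U_k(w + increment) <= U_(k+1)(w) and dominates the indicator of the bad
    event at k = 0, then U_n(0) bounds its probability
    ([iid_sum_supermartingale]).

    - For the empirical risk the potential is exponential; n being large, the
      cubic error in exp(u) <= 1 + u + u^2/2 + |u|^3/2 is negligible and the
      probability is at most (delta/2) exp(1/10) ([linear_tail_mass]).

    - For Pearson's statistic, write |w|^2 for the quadratic form with
      coefficients 1/(n p_j), of which the statistic is the value at the
      centred counts.  For m independent standard Gaussian coordinates,
      E exp(t |W|^2) is computed by the backward heat flow
      exp(a(s) |w|^2 + b(s)) with a' = 2 a^2 and a(0) = t.  The same functions,
      with a small correction to b, are a potential for the random walk itself
      as long as |w|^2 <= kappa, and beyond that value they exceed 1 after
      division by exp(t kappa), so that truncating them at 1 gives a potential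
      everywhere.  The best t gives the Laurent-Massart bound exp(-x) with
      x = ln (4/delta), because kappa = m + 2 x + 2 sqrt(m x); the error of the
      Gaussian comparison costs at most a factor exp(1/2) ([iid_chi2_tail],
      [chi2_tail_mass]).

    The total failure probability is thus at most
    (delta/4) exp(1/2) + (delta/2) exp(1/10) <= delta ([delta_split]). *)

(** * A second-order bound on the exponential *)

Lemma cubic_expN_derive (R : realType) (c x : R) :
  is_derive x 1 (fun u => (1 + u + 2^-1 * u ^+ 2 + c * u ^+ 3) * expR (- u))
    ((3 * c * x ^+ 2 - 2^-1 * x ^+ 2 - c * x ^+ 3) * expR (- x)).
Proof.
have H : is_derive x 1
    ((cst 1 + id + (2^-1 \*: (id : R -> R) ^+ 2) + (c \*: (id : R -> R) ^+ 3))
       * (expR \o -%R))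
    ((3 * c * x ^+ 2 - 2^-1 * x ^+ 2 - c * x ^+ 3) * expR (- x)).
  apply: is_derive_eq.
  rewrite /= /GRing.scale /= !fctE /=.
  rewrite [LHS](_ : _ =
    (1 + x + 2^-1 * x ^+ 2 + c * x ^+ 3) * (expR (- x) * -1) +
    expR (- x) * (0 + 1 + 2^-1 * (2 * x ^+ 1 * 1) + c * (3 * x ^+ 2 * 1))) //.
  by field.
exact: H.
Qed.

(** The product of the right-hand side with exp(-u) equals 1 at 0 and is
    monotone on each side of 0. *)
Lemma expR_le_quadratic (R : realType) (u : R) : `|u| <= 1 ->
  expR u <= 1 + u + u ^+ 2 / 2 * (1 + `|u|).
Proof.
move=> u1.
pose F c (v : R) := (1 + v + 2^-1 * v ^+ 2 + c * v ^+ 3) * expR (- v).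
have cF c (a b : R) : {within `[a, b], continuous (F c)}.
  apply: derivable_within_continuous => x _.
  by have [] := cubic_expN_derive c x.
have F0 c : F c 0 = 1 by rewrite /F oppr0 expR0; ring.
suff [c [cE F1]] : exists c, c * u ^+ 3 = u ^+ 2 / 2 * `|u| /\ 1 <= F c u.
  move: F1; rewrite /F cE => F1.
  rewrite -(ler_pM2r (expR_gt0 (- u))) expRxMexpNx_1 (le_trans F1)//.
  by rewrite mulrDr mulr1 !addrA [2^-1 * _]mulrC.
have [u0|u0] := leP 0 u.
- exists 2^-1; split; first by rewrite ger0_norm//; field.
  have [x] := @MVT_segment R _ _ 0 u u0
    (fun x _ => cubic_expN_derive 2^-1 x) (cF _ _ _).
  rewrite in_itv/= => /andP[x0 xu].
  rewrite -!/(F _ _) F0 => /eqP; rewrite subr_eq => /eqP ->.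
  rewrite lerDr subr0 mulr_ge0// mulr_ge0 ?expR_ge0//.
  have xle : x <= 1 by rewrite (le_trans xu)// (le_trans _ u1)// ler_norm.
  have -> : 3 / 2 * x ^+ 2 - 2^-1 * x ^+ 2 - 2^-1 * x ^+ 3 =
      x ^+ 2 * (1 - 2^-1 * x) by field.
  by rewrite mulr_ge0 ?sqr_ge0//; lra.
- exists (- 2^-1); split; first by rewrite ltr0_norm//; field.
  have [x] := @MVT_segment R _ _ u 0 (ltW u0)
    (fun x _ => cubic_expN_derive (- 2^-1) x) (cF _ _ _).
  rewrite in_itv/= => /andP[xu x0]; rewrite -!/(F _ _) F0 => /eqP.
  rewrite sub0r subr_eq => /eqP eq1.
  have : 0 <= - ((3 * - 2^-1 * x ^+ 2 - 2^-1 * x ^+ 2 - - 2^-1 * x ^+ 3) *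
       expR (- x) * - u); last lra.
  rewrite [leRHS](_ : _ = x ^+ 2 * (2 - 2^-1 * x) * expR (- x) * - u);
    last by field.
  rewrite mulr_ge0 ?oppr_ge0 ?(ltW u0)// mulr_ge0 ?expR_ge0//.
  by rewrite mulr_ge0 ?sqr_ge0//; lra.
Qed.

(** The exponential moment of a bounded variable is governed by its first two
    moments, with relative error U in the second-order term. *)
Lemma mean_expR_le (R : realType) (I : finType) (p u : I -> R) (U : R) :
  (forall i, 0 <= p i) -> \sum_i p i = 1 ->
  (forall i, `|u i| <= U) -> U <= 1 ->
  \sum_i p i * expR (u i) <=
    expR (\sum_i p i * u i + (1 + U) / 2 * \sum_i p i * u i ^+ 2).
Proof.
move=> p0 p1 uU U1; apply: le_trans (expR_ge1Dx _).
rewrite -[X in _ <= X + _]p1 mulr_sumr -!big_split/=; apply: ler_sum => i _.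
rewrite [leRHS](_ : _ = p i * (1 + u i + u i ^+ 2 / 2 * (1 + U)));
  last by field.
rewrite ler_wpM2l//.
apply: le_trans (expR_le_quadratic (le_trans (uU i) U1)) _.
by rewrite lerD2l ler_wpM2l ?lerD2l// divr_ge0 ?sqr_ge0.
Qed.

(** * Tail events of iid sums on finite spaces *)

Section iid_sum.
Context (R : realType) (I : finType).

(** The sample whose first value is [i] and whose later values are given by
    [g]. *)
Definition ffun_cons n (i : I) (g : {ffun 'I_n -> I}) : {ffun 'I_n.+1 -> I} :=
  [ffun k => if unlift ord0 k is Some j then g j else i].

Lemma ffun_cons0 n i (g : {ffun 'I_n -> I}) : ffun_cons i g ord0 = i.
Proof. by rewrite ffunE unlift_none. Qed.

Lemma ffun_consS n i (g : {ffun 'I_n -> I}) k :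
  ffun_cons i g (lift ord0 k) = g k.
Proof. by rewrite ffunE liftK. Qed.

Lemma sum_ffun_cons n (G : {ffun 'I_n.+1 -> I} -> R) :
  \sum_f G f = \sum_i \sum_g G (ffun_cons i g).
Proof.
rewrite pair_bigA /= (reindex (fun ig => ffun_cons ig.1 ig.2))//=.
exists (fun f => (f ord0, [ffun k => f (lift ord0 k)])) => [[i g] _|f _] /=.
  rewrite ffun_cons0; congr (_, _); apply/ffunP => k.
  by rewrite ffunE ffun_consS.
apply/ffunP => k; rewrite ffunE.
by case: unliftP => [j ->|->//]; rewrite ffunE.
Qed.

(** Here [k] counts the remaining increments and [f] ranges over samples,
    weighted by their product probability. *)
Lemma iid_sum_supermartingale (S : zmodType) (p : I -> R) (e : I -> S)
    (bad : pred S) (U : nat -> S -> R) (n : nat) :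
  (forall i, 0 <= p i) ->
  (forall w, 0 <= U 0%N w) -> (forall w, bad w -> 1 <= U 0%N w) ->
  (forall k w, (k < n)%N -> \sum_i p i * U k (w + e i) <= U k.+1 w) ->
  forall w, \sum_(f : {ffun 'I_n -> I} | bad (w + \sum_k e (f k)))
    \prod_k p (f k) <= U n w.
Proof.
move=> p0 U0 U1; elim: n => [|n IH] step w.
  rewrite big_mkcond/= (eq_bigr (fun=> if bad w then 1 else 0)); last first.
    by move=> f _; rewrite !big_ord0 addr0.
  rewrite sumr_const card_ffun card_ord expn0 mulr1n.
  by case: ifPn => [/U1//|_].
rewrite big_mkcond/= sum_ffun_cons; apply: le_trans (step n w (ltnSn n)).
apply: ler_sum => i _.
have {}IH := IH (fun k w kn => step k w (ltnW kn)) (w + e i).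
apply: le_trans (ler_wpM2l (p0 i) IH).
rewrite mulr_sumr [leRHS]big_mkcond/=; apply: ler_sum => g _.
rewrite !big_ord_recl/= !ffun_cons0 addrA.
under eq_bigr do rewrite ffun_consS.
by under [X in _ * X]eq_bigr do rewrite ffun_consS.
Qed.

End iid_sum.

(** Bernstein-type bound.  A cubic error term replaces Hoeffding's lemma, so
    only the variance and a crude bound on [c] are needed. *)
Lemma iid_mean_tail (R : realType) (I : finType) (p c : I -> R) (n : nat)
    (s T : R) :
  (forall i, 0 <= p i) -> \sum_i p i = 1 ->
  (forall i, `|c i| <= 2) -> \sum_i p i * c i = 0 ->
  \sum_i p i * c i ^+ 2 <= 1 ->
  0 <= s -> 2 * s <= 1 ->
  \sum_(f : {ffun 'I_n -> I} | T < \sum_k c (f k)) \prod_k p (f k) <=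
    expR (n%:R * (s ^+ 2 / 2 + s ^+ 3) - s * T).
Proof.
move=> p0 p1 c2 pc pc2 s0 s1.
pose L := s ^+ 2 / 2 + s ^+ 3.
pose U k (w : R) := expR (s * (w - T) + k%:R * L).
have U0 w : 0 <= U 0%N w by exact: expR_ge0.
have U1 w : T < w -> 1 <= U 0%N w.
  move=> Tw; rewrite /U mul0r addr0 -[leLHS]expR0 ler_expR mulr_ge0// subr_ge0.
  exact: ltW.
suff step k w : (k < n)%N -> \sum_i p i * U k (w + c i) <= U k.+1 w.
  have := @iid_sum_supermartingale R I R p c (fun w => T < w) U n
    p0 U0 U1 step 0.
  rewrite /U sub0r mulrN addrC; under eq_bigl do rewrite add0r; exact.
move=> _; rewrite /U.
have -> : \sum_i p i * expR (s * (w + c i - T) + k%:R * L) =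
    expR (s * (w - T) + k%:R * L) * \sum_i p i * expR (s * c i).
  rewrite mulr_sumr; apply: eq_bigr => i _.
  rewrite mulrCA -expRD; congr (_ * expR _); ring.
rewrite -natr1 mulrDl mul1r addrA [leRHS]expRD ler_wpM2l ?expR_ge0//.
apply: le_trans (@mean_expR_le _ _ p (fun i => s * c i) (2 * s) p0 p1 _ s1) _.
  by move=> i; rewrite normrM ger0_norm// mulrC ler_wpM2r.
rewrite ler_expR.
under eq_bigr do rewrite mulrCA; rewrite -mulr_sumr pc mulr0 add0r.
under eq_bigr do rewrite exprMn mulrCA; rewrite -mulr_sumr.
have -> : L = (1 + 2 * s) / 2 * (s ^+ 2 * 1) by rewrite /L; field.
rewrite ler_wpM2l ?divr_ge0 ?addr_ge0 ?mulr_ge0//.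
by rewrite ler_wpM2l ?sqr_ge0.
Qed.

(** * One step of the centred counts *)

Section chi2_potential.
Context (R : realType) (I : finType) (p : I -> R) (N pmin : R).
Hypotheses (pmin_gt0 : 0 < pmin) (pmin_le : forall i, pmin <= p i).
Hypotheses (p1 : \sum_i p i = 1) (N_gt0 : 0 < N).

(** The squared norm for which the centred counts of an iid sample have, up to a
    projection, identity covariance; at the centred counts of [N] samples it is
    Pearson's statistic. *)
Definition chi2_form (w : {ffun I -> R}) : R := N^-1 * \sum_j w j ^+ 2 / p j.

(** The centred count vector of the single observation [i]. *)
Definition centered_unit (i : I) : {ffun I -> R} :=
  [ffun j => (j == i)%:R - p j].

Let p_gt0 i : 0 < p i. Proof. exact: lt_le_trans (pmin_le i). Qed.
Let p_ge0 i : 0 <= p i. Proof. exact: ltW. Qed.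
Let Ni_ge0 : 0 <= N^-1. Proof. by rewrite invr_ge0 ltW. Qed.
Let N_neq0 : N != 0. Proof. by rewrite gt_eqF. Qed.
Let p_neq0 i : p i != 0. Proof. by rewrite gt_eqF. Qed.

Lemma chi2_form_ge0 w : 0 <= chi2_form w.
Proof.
rewrite /chi2_form mulr_ge0// sumr_ge0// => j _.
by rewrite divr_ge0 ?sqr_ge0.
Qed.

(* Twice B is the cross term and D the squared norm of the increment. *)
Let B (w : {ffun I -> R}) i : R := N^-1 * (w i / p i - \sum_j w j).
Let D i : R := N^-1 * ((p i)^-1 - 1).

Lemma chi2_formD w i :
  chi2_form (w + centered_unit i) = chi2_form w + (2 * B w i + D i).
Proof.
rewrite /chi2_form /B /D.
have -> : \sum_j (w + centered_unit i) j ^+ 2 / p j =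
    \sum_j (w j ^+ 2 / p j + (2 * ((j == i)%:R * (w j / p j)) - 2 * w j) +
     ((j == i)%:R * (p j)^-1 - 2 * (j == i)%:R + p j)).
  apply: eq_bigr => j _; rewrite !ffunE; have := p_neq0 j.
  by case: (j == i) => /= pj; field.
rewrite !big_split/= !sumrN p1 -!mulr_sumr.
have E (f : I -> R) : \sum_j (j == i)%:R * f j = f i.
  rewrite (bigD1 i)//= eqxx mul1r big1 ?addr0// => j /negbTE ->.
  by rewrite mul0r.
have E1 : \sum_j (j == i)%:R = 1 :> R.
  by have := E (fun=> 1); under eq_bigr do rewrite mulr1.
rewrite !E E1; ring.
Qed.

Let sumB w : \sum_i p i * B w i = 0.
Proof.
rewrite (eq_bigr (fun i => N^-1 * (w i - p i * \sum_j w j))); last first.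
  by move=> i _; have pi_neq0 := p_neq0 i; rewrite /B; field; rewrite N_neq0.
by rewrite -mulr_sumr sumrB -mulr_suml p1 mul1r subrr mulr0.
Qed.

Let sumB2 w : \sum_i p i * B w i ^+ 2 <= N^-1 * chi2_form w.
Proof.
rewrite (eq_bigr (fun i => N^-1 ^+ 2 * (w i ^+ 2 / p i - 2 * (\sum_j w j) * w i
     + (\sum_j w j) ^+ 2 * p i))); last first.
  move=> i _; have pi_neq0 := p_neq0 i; rewrite /B; set S := \sum_j _.
  by field; rewrite N_neq0 ?pi_neq0.
rewrite -mulr_sumr big_split/= sumrB -!mulr_sumr p1 /chi2_form.
set S := \sum_j w j; set X := \sum_j _.
rewrite [leRHS](_ : _ = N^-1 ^+ 2 * X); last by rewrite expr2 mulrA.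
rewrite ler_wpM2l ?sqr_ge0//; have := sqr_ge0 S; lra.
Qed.

Let D_ge0 i : 0 <= D i.
Proof.
rewrite /D mulr_ge0// subr_ge0 invf_ge1// -p1.
by rewrite (bigD1 i)//= lerDl sumr_ge0.
Qed.

Let D_le i : D i <= (N * pmin)^-1.
Proof.
rewrite /D invfM ler_wpM2l//.
by rewrite lerBlDr ler_wpDr// lef_pV2 ?posrE.
Qed.

Let sumD : \sum_i p i * D i = N^-1 * (#|I|%:R - 1).
Proof.
rewrite (eq_bigr (fun i => N^-1 * (1 - p i))); last first.
  by move=> i _; have pi_neq0 := p_neq0 i; rewrite /D; field; rewrite N_neq0.
by rewrite -mulr_sumr sumrB p1 sumr_const.
Qed.

(** A Gaussian step of the same covariance would turn the coefficient [a] into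
    about a + 2 a^2 / N and add about a * (#|I| - 1) / N to the exponent.  For a
    step of the random walk (a * #|I| + 1/2) / N suffices, provided that the
    higher-order terms are small: [r] bounds half of the cross term, [e] the
    squared norm of an increment and [U] the whole variation of the exponent. *)
Lemma chi2_form_step (w : {ffun I -> R}) (a A kappa r e U : R) :
  0 <= a -> a <= A -> chi2_form w <= kappa ->
  0 <= r -> r ^+ 2 = kappa / (N * pmin) -> e = (N * pmin)^-1 ->
  U = A * (2 * r + e) -> U <= 1 ->
  2 * U * A ^+ 2 * kappa
    + (1 + U) / 2 * A ^+ 2 * (4 * r + e) * #|I|%:R <= 2^-1 ->
  \sum_i p i * expR (a * chi2_form (w + centered_unit i)) <=
  expR ((a + 2 * a ^+ 2 / N) * chi2_form w + (a * #|I|%:R + 2^-1) / N).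
Proof.
move=> a0 aA Qk r0 r2 eE UE U1 err.
have e0 : 0 < e by rewrite eE invr_gt0 mulr_gt0.
have A0 : 0 <= A by apply: le_trans aA.
have U0 : 0 <= U by rewrite UE mulr_ge0// addr_ge0 ?mulr_ge0 ?(ltW e0).
set Q := chi2_form w in Qk *; have Q0 : 0 <= Q := chi2_form_ge0 w.
(* Each term of the sum bounded in [sumB2] is at most the bound. *)
have Br i : `|B w i| <= r.
  rewrite -(@ler_pXn2r _ 2)// ?nnegrE// real_normK ?num_real//.
  rewrite r2 -(ler_pM2l pmin_gt0).
  have /le_trans : pmin * B w i ^+ 2 <= p i * B w i ^+ 2.
    by rewrite ler_wpM2r ?sqr_ge0.
  apply; have /le_trans : p i * B w i ^+ 2 <= N^-1 * Q.
    apply: le_trans (sumB2 w).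
    rewrite [leRHS](bigD1 i)//= lerDl sumr_ge0// => j _.
    by rewrite mulr_ge0 ?sqr_ge0.
  apply; have -> : pmin * (kappa / (N * pmin)) = N^-1 * kappa.
    by field; rewrite N_neq0 gt_eqF.
  by rewrite ler_wpM2l.
have De i : D i <= e by rewrite eE.
pose u i := a * (2 * B w i + D i).
have uU i : `|u i| <= U.
  rewrite /u normrM ger0_norm// UE ler_pM//.
  apply: le_trans (ler_normD _ _) _; rewrite normrM (ger0_norm (D_ge0 i)).
  by rewrite (ger0_norm (ler0n _ 2))// lerD// ler_wpM2l.
have -> : \sum_i p i * expR (a * chi2_form (w + centered_unit i)) =
   expR (a * Q) * \sum_i p i * expR (u i).
  rewrite mulr_sumr; apply: eq_bigr => i _.
  by rewrite chi2_formD [RHS]mulrCA -expRD mulrDr.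
apply: le_trans (ler_wpM2l (expR_ge0 _) (@mean_expR_le _ _ p u U _ p1 uU U1)) _.
  by [].
rewrite -expRD ler_expR.
have -> : \sum_i p i * u i = a * (N^-1 * (#|I|%:R - 1)).
  rewrite -sumD.
  transitivity (a * (2 * \sum_i p i * B w i + \sum_i p i * D i)); last first.
    by rewrite sumB mulr0 add0r.
  rewrite [2 * _]mulr_sumr -big_split/= mulr_sumr.
  by apply: eq_bigr => i _; rewrite /u; ring.
have m0 : 0 <= #|I|%:R :> R by [].
set m : R := #|I|%:R in err m0 *.
have u2 : \sum_i p i * u i ^+ 2 <= a ^+ 2 * (N^-1 * (4 * Q + (4 * r + e) * m)).
  rewrite (eq_bigr (fun i => a ^+ 2 * (4 * (p i * B w i ^+ 2) +
      p i * D i * (4 * B w i + D i)))); last by move=> i _; rewrite /u; ring.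
  rewrite -mulr_sumr ler_wpM2l ?sqr_ge0// mulrDr big_split/= -mulr_sumr.
  rewrite lerD//; first by rewrite mulrCA ler_wpM2l// sumB2.
  apply: (@le_trans _ _ (\sum_i p i * D i * (4 * r + e))).
    apply: ler_sum => i _; apply: ler_wpM2l; first by rewrite mulr_ge0.
    apply: lerD => //; apply: ler_wpM2l => //.
    exact: le_trans (ler_norm _) (Br i).
  rewrite -mulr_suml sumD -/m -mulrA; apply: ler_wpM2l => //.
  rewrite mulrC; apply: ler_wpM2l; last lra.
  by rewrite addr_ge0 ?mulr_ge0 ?(ltW e0).
apply: le_trans (lerD (lexx _) (lerD (lexx _) (ler_wpM2l _ u2))) _.
  by rewrite divr_ge0// addr_ge0.
have N0 : N != 0 by rewrite gt_eqF.
rewrite -subr_ge0.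
set X := (X in 0 <= X).
have -> : X = N^-1 * (a + (2^-1 -
    (2 * U * a ^+ 2 * Q + (1 + U) / 2 * a ^+ 2 * (4 * r + e) * m))).
  by rewrite /X; field.
rewrite mulr_ge0// addr_ge0// subr_ge0 (le_trans _ err)//.
have a2 : a ^+ 2 <= A ^+ 2 by rewrite ler_pXn2r// nnegrE.
have re0 : 0 <= 4 * r + e by rewrite addr_ge0 ?mulr_ge0 ?(ltW e0).
rewrite lerD//; last first.
  by rewrite (ler_wpM2r m0)// (ler_wpM2r re0)// ler_wpM2l// divr_ge0// addr_ge0.
have U20 : 0 <= 2 * U by rewrite mulr_ge0.
by rewrite ler_pM// ?(mulr_ge0 U20) ?sqr_ge0// ler_wpM2l.
Qed.

End chi2_potential.

(** * The chi-square tail bound *)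

Section heat.
Context (R : realType) (X M : R).
Hypotheses (X0 : 0 < X) (M0 : 0 < M).

(** The solution a(s) = t / (1 - 2 t s) of a' = 2 a^2 for t = X / (2 X + M), the
    exponent that is optimal in the Chernoff bound when X^2 is the deviation
    parameter and M^2 the number of degrees of freedom; a(1) = X / M. *)
Definition heat_coef (s : R) : R := X / (2 * X + M - 2 * X * s).

(** The additive term of the exponent: M^2 times the integral from 0 to s of the
    chord of the convex function a, plus s / 2 for the accumulated errors. *)
Definition heat_cst (s : R) : R :=
  M ^+ 2 * (X / (2 * X + M) * s
            + (X / M - X / (2 * X + M)) * (s ^+ 2 / 2)) + s / 2.

Let d0 : 0 < 2 * X + M. Proof. by rewrite addr_gt0 ?mulr_gt0. Qed.

Let d_gt0 s : s <= 1 -> 0 < 2 * X + M - 2 * X * s.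
Proof.
move=> s1; have : 0 <= X * (1 - s) by rewrite mulr_ge0 ?subr_ge0 ?(ltW X0).
by have := M0; lra.
Qed.

Lemma heat_coef_ge0 s : s <= 1 -> 0 <= heat_coef s.
Proof. by move=> s1; rewrite divr_ge0 ?(ltW X0) ?(ltW (d_gt0 s1)). Qed.

Lemma heat_coef_mono s u : s <= u -> u <= 1 -> heat_coef s <= heat_coef u.
Proof.
move=> su u1; have s1 := le_trans su u1.
rewrite ler_wpM2l ?(ltW X0)// lef_pV2 ?posrE ?d_gt0// lerD2l lerN2.
by rewrite ler_wpM2l// mulr_ge0// ltW.
Qed.

(** The difference quotient of a is 2 a(s) a(s + h), which is at least
    2 a(s)^2. *)
Lemma heat_coef_step s h : 0 <= h -> s + h <= 1 ->
  heat_coef s + 2 * heat_coef s ^+ 2 * h <= heat_coef (s + h).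
Proof.
move=> h0 sh; have s1 : s <= 1 by lra.
have d1 := d_gt0 s1; have d2 := d_gt0 sh.
have E : heat_coef (s + h) =
    heat_coef s + 2 * heat_coef s * heat_coef (s + h) * h.
  by rewrite /heat_coef; field; rewrite !gt_eqF.
have a0 := heat_coef_ge0 s1.
have aa : heat_coef s <= heat_coef (s + h) by rewrite heat_coef_mono// lerDl.
rewrite [leRHS]E lerD2l; apply: ler_wpM2r => //.
by rewrite expr2 mulrA ler_wpM2l// mulr_ge0.
Qed.

Lemma heat_coef_chord s : 0 <= s -> s <= 1 ->
  heat_coef s <= X / (2 * X + M) + (X / M - X / (2 * X + M)) * s.
Proof.
move=> s0 s1; have d1 := d_gt0 s1.
rewrite /heat_coef ler_pdivrMr// -subr_ge0.
rewrite [leRHS](_ : _ = 4 * X ^+ 3 * (s * (1 - s)) / (M * (2 * X + M)));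
  last first.
  by field; rewrite !gt_eqF.
by rewrite divr_ge0 ?mulr_ge0 ?exprn_ge0 ?(ltW X0) ?(ltW M0) ?(ltW d0)
  ?subr_ge0.
Qed.

Lemma heat_cst_step s h : 0 <= h -> 0 <= s -> s <= 1 ->
  heat_cst s + (heat_coef s * M ^+ 2 + 2^-1) * h <= heat_cst (s + h).
Proof.
move=> h0 s0 s1.
apply: (@le_trans _ _ (heat_cst s +
  ((X / (2 * X + M) + (X / M - X / (2 * X + M)) * s) * M ^+ 2 + 2^-1) * h)).
  by rewrite lerD2l ler_wpM2r// lerD2r ler_wpM2r ?sqr_ge0// heat_coef_chord.
have tA : 0 <= X / M - X / (2 * X + M).
  rewrite subr_ge0 ler_wpM2l ?(ltW X0)// lef_pV2 ?posrE//.
  by rewrite lerDr mulr_ge0// ltW.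
rewrite -subr_ge0 /heat_cst.
set t := X / (2 * X + M) in tA *; set dA := (X / M - t) in tA *.
rewrite [leRHS](_ : _ = M ^+ 2 * dA * (h ^+ 2 / 2)); last by field.
by rewrite mulr_ge0 ?divr_ge0 ?sqr_ge0// mulr_ge0 ?sqr_ge0.
Qed.

Lemma heat_cst_ge0 s : 0 <= s -> 0 <= heat_cst s.
Proof.
move=> s0.
have tA : 0 <= X / M - X / (2 * X + M).
  rewrite subr_ge0 ler_wpM2l ?(ltW X0)// lef_pV2 ?posrE//.
  by rewrite lerDr mulr_ge0// ltW.
have t0 : 0 <= X / (2 * X + M) by rewrite divr_ge0// ltW.
have s2 : 0 <= s ^+ 2 / 2 by rewrite divr_ge0 ?sqr_ge0.
rewrite addr_ge0 ?(divr_ge0 s0)// mulr_ge0 ?sqr_ge0// addr_ge0 ?(mulr_ge0 t0)//.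
by rewrite mulr_ge0.
Qed.

(** The Laurent-Massart computation: using the chord in place of a loses nothing
    against the threshold M^2 + 2 X^2 + 2 M X. *)
Lemma heat_cst1 :
  heat_cst 1 - heat_coef 0 * (M ^+ 2 + 2 * X ^+ 2 + 2 * (M * X)) =
  - X ^+ 2 + 2^-1.
Proof.
rewrite /heat_cst /heat_coef mulr0 subr0.
by field; rewrite !gt_eqF.
Qed.

End heat.

Lemma chi2_form0 (R : realType) (I : finType) (p : I -> R) N :
  chi2_form p N 0 = 0.
Proof.
by rewrite /chi2_form big1 ?mulr0// => j _; rewrite ffunE expr0n mul0r.
Qed.

(** Up to the factor exp(1/2), Pearson's statistic satisfies the tail bound of a
    chi-square variable with #|I| degrees of freedom. *)
Lemma iid_chi2_tail (R : realType) (I : finType) (p : I -> R) (pmin : R)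
    (n : nat) (X M r e U : R) (kappa := M ^+ 2 + 2 * X ^+ 2 + 2 * (M * X)) :
  0 < pmin -> (forall i, pmin <= p i) -> \sum_i p i = 1 -> (0 < n)%N ->
  0 < X -> 0 < M -> M ^+ 2 = #|I|%:R ->
  0 <= r -> r ^+ 2 = kappa / (n%:R * pmin) -> e = (n%:R * pmin)^-1 ->
  U = X / M * (2 * r + e) -> U <= 1 ->
  2 * U * (X / M) ^+ 2 * kappa
    + (1 + U) / 2 * (X / M) ^+ 2 * (4 * r + e) * M ^+ 2 <= 2^-1 ->
  \sum_(f : {ffun 'I_n -> I} |
      kappa < chi2_form p n%:R (\sum_k centered_unit p (f k)))
    \prod_k p (f k) <= expR (- X ^+ 2 + 2^-1).
Proof.
move=> pmin_gt0 pmin_le p1 n0 X0 M0 M2 r0 r2 eE UE U1 err.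
have N0 : 0 < n%:R :> R by rewrite ltr0n.
pose Q := chi2_form p n%:R.
have Q0 w : 0 <= Q w := @chi2_form_ge0 R I p n%:R pmin pmin_gt0 pmin_le N0 w.
have p0 i : 0 <= p i by rewrite ltW// (lt_le_trans pmin_gt0).
have k0 : 0 <= kappa.
  by rewrite /kappa !addr_ge0 ?mulr_ge0 ?sqr_ge0 ?(ltW X0) ?(ltW M0).
pose a (k : nat) := heat_coef X M (k%:R / n%:R).
pose b (k : nat) := heat_cst X M (k%:R / n%:R).
pose H k (w : {ffun I -> R}) := expR (a k * Q w + b k - a 0%N * kappa).
(* One step is controlled only below kappa; above it the exponential exceeds 1
   and the truncation makes the inequality trivial. *)
pose V k w := Num.min 1 (H k w).
have V1 k w : V k w <= 1 by rewrite ge_min lexx.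
have Ve k w : V k w <= H k w by rewrite ge_min lexx orbT.
have s0 k : 0 <= k%:R / n%:R :> R by rewrite divr_ge0// ltW.
have s1 k : (k <= n)%N -> k%:R / n%:R <= 1 :> R.
  by move=> kn; rewrite ler_pdivrMr// mul1r ler_nat.
have big k w : (k <= n)%N -> kappa <= Q w -> 1 <= V k w.
  move=> kn kQ; rewrite le_min lexx/= -[leLHS]expR0 ler_expR.
  have aa : a 0%N <= a k by apply: heat_coef_mono => //; rewrite ?s1// mul0r.
  have a0 : 0 <= a 0%N by apply: heat_coef_ge0 => //; rewrite mul0r.
  have : 0 <= b k by exact: heat_cst_ge0.
  have : a 0%N * kappa <= a k * Q w by rewrite ler_pM.
  lra.
have V0 w : 0 <= V 0%N w by rewrite le_min ler01 expR_ge0.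
have Vbad w : kappa < Q w -> 1 <= V 0%N w by move=> kQ; rewrite big// ltW.
have step k w : (k < n)%N ->
    \sum_i p i * V k (w + centered_unit p i) <= V k.+1 w.
  move=> kn.
  have le1 : \sum_i p i * V k (w + centered_unit p i) <= 1.
    by rewrite -p1; apply: ler_sum => i _; rewrite ler_piMr.
  have [kQ|Qk] := leP kappa (Q w); first exact: le_trans le1 (big _ _ kn kQ).
  rewrite [leRHS]/V le_min le1/=.
  apply: (@le_trans _ _ (\sum_i p i * H k (w + centered_unit p i))).
    by apply: ler_sum => i _; rewrite ler_wpM2l.
  have -> : \sum_i p i * H k (w + centered_unit p i) =
      expR (b k - a 0%N * kappa) *
      \sum_i p i * expR (a k * Q (w + centered_unit p i)).
    rewrite mulr_sumr; apply: eq_bigr => i _.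
    by rewrite [RHS]mulrCA -expRD; congr (_ * expR _); ring.
  have kS : k.+1%:R / n%:R = k%:R / n%:R + n%:R^-1 :> R.
    by rewrite -natr1 mulrDl mul1r.
  have ni0 : 0 <= n%:R^-1 :> R by rewrite invr_ge0.
  have a0 : 0 <= a k by apply: heat_coef_ge0 => //; rewrite s1// ltnW.
  have aA : a k <= X / M.
    have -> : X / M = heat_coef X M 1.
      by rewrite /heat_coef mulr1 addrAC subrr add0r.
    by apply: heat_coef_mono => //; rewrite s1// ltnW.
  have e2 : 2 * U * (X / M) ^+ 2 * kappa
      + (1 + U) / 2 * (X / M) ^+ 2 * (4 * r + e) * #|I|%:R <= 2^-1.
    by rewrite -M2.
  have := @chi2_form_step R I p n%:R pmin pmin_gt0 pmin_le p1 N0 w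
    (a k) (X / M) kappa r e U a0 aA (ltW Qk) r0 r2 eE UE U1 e2.
  move=> /(ler_wpM2l (expR_ge0 (b k - a 0%N * kappa))) /le_trans; apply.
  rewrite -expRD ler_expR -M2 -/Q.
  have := @heat_coef_step R X M X0 M0 (k%:R / n%:R) n%:R^-1 ni0.
  rewrite -kS => /(_ (s1 _ kn)) /(ler_wpM2r (Q0 w)) A1.
  have A2 := @heat_cst_step R X M X0 M0 (k%:R / n%:R) n%:R^-1
    ni0 (s0 k) (s1 _ (ltnW kn)).
  rewrite -kS in A2; move: A1 A2; rewrite -/(a _) -/(a _) -/(b _) -/(b _); lra.
have := @iid_sum_supermartingale R I _ p (centered_unit p)
  (fun w => kappa < Q w) V n p0 V0 Vbad step 0.
move=> /le_trans; under eq_bigl do rewrite add0r; apply.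
apply: le_trans (Ve _ _) _; rewrite /H /Q chi2_form0 mulr0 add0r.
by rewrite /a /b mul0r divff ?gt_eqF// heat_cst1.
Qed.

(** * Numerical estimates *)

Lemma expR_ge_quartic (R : realType) (x : R) : 0 <= x ->
  1 + x / 3 + x ^+ 2 / 24 <= expR (x / 3).
Proof.
move=> x0.
have E : expR (x / 3) = expR (x / 12) ^+ 4.
  by rewrite -expRM_natl; congr expR; field.
have x12 : 0 <= x / 12 by rewrite divr_ge0.
rewrite E; apply: (@le_trans _ _ ((1 + x / 12) ^+ 4)).
  have -> : (1 + x / 12) ^+ 4 = 1 + x / 3 + x ^+ 2 / 24 +
     (4 * (x / 12) ^+ 3 + (x / 12) ^+ 4) by field.
  by rewrite lerDl addr_ge0 ?mulr_ge0 ?exprn_ge0.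
by rewrite lerXn2r ?nnegrE ?expR_ge0 ?expR_ge1Dx// addr_ge0.
Qed.

(** The hypothesis of [chi2_form_step] on the higher-order terms.  Everything is
    bounded by powers of q = (X / M) sqrt kappa, which is of order X + X^2,
    against the factor exp(- X^2) contained in sqrt e. *)
Lemma chi2_error_le (R : realType) (X M e c : R)
    (kappa := M ^+ 2 + 2 * X ^+ 2 + 2 * (M * X))
    (r := Num.sqrt (kappa * e)) (U := X / M * (2 * r + e)) :
  0 < X -> 1 <= M -> 0 <= e -> 0 <= c -> c <= 250^-1 ->
  e <= (c * expR (- X ^+ 2) / M ^+ 4) ^+ 2 ->
  [/\ r < 1, U <= 1 &
   2 * U * (X / M) ^+ 2 * kappa
     + (1 + U) / 2 * (X / M) ^+ 2 * (4 * r + e) * M ^+ 2 <= 2^-1].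
Proof.
move=> X0 M1 e0 c0 c1; set g := c * expR (- X ^+ 2); set h := g / M ^+ 4 => eh.
have M0 : 0 < M by apply: lt_le_trans M1.
have kappa0 : 0 <= kappa.
  by rewrite /kappa !addr_ge0 ?mulr_ge0 ?sqr_ge0 ?(ltW X0) ?(ltW M0).
pose K := Num.sqrt kappa; have K0 : 0 <= K := sqrtr_ge0 _.
have K2 : K ^+ 2 = kappa by rewrite sqr_sqrtr.
have KM : M <= K.
  rewrite -(@ler_pXn2r _ 2) ?nnegrE ?(ltW M0)// K2 /kappa.
  by rewrite -addrA lerDl addr_ge0 ?mulr_ge0 ?sqr_ge0 ?(ltW X0) ?(ltW M0).
(* 3/2 is a rational bound of sqrt 2 with room to spare. *)
have KU : K <= M + 3 / 2 * X.
  rewrite -(@ler_pXn2r _ 2) ?nnegrE ?addr_ge0 ?mulr_ge0 ?(ltW X0) ?(ltW M0)//.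
  rewrite K2 -subr_ge0 (_ : _ - _ = M * X + X ^+ 2 / 4);
    last by rewrite /kappa; field.
  by rewrite addr_ge0 ?mulr_ge0 ?sqr_ge0 ?(ltW X0) ?(ltW M0).
pose A := X / M; have A0 : 0 <= A by rewrite divr_ge0 ?(ltW X0) ?(ltW M0).
pose q := A * K; have q0 : 0 <= q by rewrite mulr_ge0.
have Aq : A <= q by rewrite ler_peMr// (le_trans M1).
have Xq : X <= q by rewrite /q /A mulrAC ler_pdivlMr// ler_wpM2l// ltW.
have g0 : 0 <= g by rewrite mulr_ge0 ?expR_ge0.
have g4 : g <= c.
  by rewrite ler_piMr// -[leRHS]expR0 ler_expR oppr_le0 sqr_ge0.
pose E := expR (X ^+ 2 / 3); have E0 : 0 < E := expR_gt0 _.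
have E1 : 1 <= E by rewrite -[leLHS]expR0 ler_expR divr_ge0 ?sqr_ge0.
have gE : g * E ^+ 3 = c.
  rewrite /g /E -expRM_natl -mulrA -expRD [_ + _](_ : _ = 0) ?expR0 ?mulr1//.
  by field.
(* q^3 is compared with exp(X^2) = E^3; 29/10 is small enough for the final
   numerical bound. *)
have qE : q <= 29 / 10 * E.
  have EE := expR_ge_quartic (sqr_ge0 X).
  apply: (@le_trans _ _ (X + 3 / 2 * X ^+ 2)).
    apply: (@le_trans _ _ (A * (M + 3 / 2 * X))); first by rewrite ler_wpM2l.
    have -> : A * (M + 3 / 2 * X) = X + 3 / 2 * (X ^+ 2 / M).
      by rewrite /A; field; rewrite gt_eqF.
    by rewrite lerD2l ler_wpM2l// ler_pdivrMr// ler_peMr// sqr_ge0.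
  apply: (@le_trans _ _ (29 / 10 * (1 + X ^+ 2 / 3 + (X ^+ 2) ^+ 2 / 24)));
    last first.
    by rewrite ler_wpM2l.
  have X2 : X <= (1 + X ^+ 2) / 2.
    rewrite -subr_ge0 (_ : _ - _ = (1 - X) ^+ 2 / 2); last by field.
    by rewrite divr_ge0 ?sqr_ge0.
  (* The quadratic inequality left in X^2 is closest to equality near 13/3. *)
  have : 0 <= (X ^+ 2 - 13 / 3) ^+ 2 by exact: sqr_ge0.
  have : 0 <= X ^+ 2 by exact: sqr_ge0.
  move: X2; set Y := X ^+ 2; rewrite sqrrB; lra.
have CE : 0 <= 29 / 10 * E by rewrite mulr_ge0 ?divr_ge0// ltW.
have qg3 : q ^+ 3 * g <= 1 / 10.
  apply: (@le_trans _ _ ((29 / 10 * E) ^+ 3 * g)).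
    by rewrite ler_wpM2r// lerXn2r ?nnegrE.
  by rewrite exprMn -mulrA [E ^+ 3 * g]mulrC gE; lra.
have qg2 : q ^+ 2 * g <= 1 / 25.
  apply: (@le_trans _ _ ((29 / 10 * E) ^+ 2 * g)).
    by rewrite ler_wpM2r// lerXn2r ?nnegrE.
  apply: (@le_trans _ _ ((29 / 10) ^+ 2 * (g * E ^+ 3)));
    last by rewrite gE; lra.
  rewrite exprMn -mulrA ler_wpM2l ?sqr_ge0// mulrC ler_wpM2l//.
  by rewrite ler_weXn2l.
have qg1 : q * g <= 1 / 80.
  apply: (@le_trans _ _ ((29 / 10 * E) * g)); first by rewrite ler_wpM2r.
  apply: (@le_trans _ _ ((29 / 10) * (g * E ^+ 3))); last by rewrite gE; lra.
  rewrite -mulrA ler_wpM2l// mulrC ler_wpM2l//.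
  by rewrite -[leLHS]expr1 ler_weXn2l.
have M4 : 0 < M ^+ 4 by rewrite exprn_gt0.
have h0 : 0 <= h by rewrite divr_ge0 ?(ltW M4).
have M21 : 1 <= M ^+ 2 by rewrite exprn_ege1.
have hM2 : h * M ^+ 2 <= g.
  rewrite /h mulrAC ler_pdivrMr// ler_wpM2l//.
  by rewrite ler_weXn2l.
have hg : h <= g by apply: le_trans hM2; rewrite ler_peMr.
have r0 : 0 <= r := sqrtr_ge0 _.
have Kh : 0 <= K * h by exact: mulr_ge0.
have r2 : r ^+ 2 = kappa * e by rewrite sqr_sqrtr// mulr_ge0.
have rK : r <= K * h.
  by rewrite -(@ler_pXn2r _ 2) ?nnegrE// r2 exprMn K2 ler_wpM2l.
have Ar : A * r <= q * g.
  by rewrite /q -mulrA ler_wpM2l// (le_trans rK)// ler_wpM2l.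
have eg : e <= g * c.
  apply: le_trans eh _; rewrite expr2 ler_pM// (le_trans hg)//.
have Ae : A * e <= q * g * c.
  by rewrite -mulrA ler_pM.
have T1 : A ^+ 3 * kappa * r <= 1 / 10.
  apply: le_trans qg3; rewrite -K2.
  apply: (@le_trans _ _ (A ^+ 3 * K ^+ 2 * (K * h))).
    by rewrite ler_wpM2l// mulr_ge0 ?sqr_ge0 ?exprn_ge0.
  rewrite (_ : _ * (K * h) = q ^+ 3 * h); last by rewrite /q; ring.
  by rewrite ler_wpM2l// exprn_ge0.
have T2 : A ^+ 3 * kappa * e <= (1 / 10) * c.
  apply: (@le_trans _ _ (q ^+ 3 * (g * c))); last first.
    by rewrite mulrA ler_wpM2r.
  have AK : 0 <= A ^+ 3 * K ^+ 2 by rewrite mulr_ge0 ?exprn_ge0.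
  rewrite -K2; apply: ler_pM => //.
  rewrite (_ : A ^+ 3 * K ^+ 2 = A * q ^+ 2); last by rewrite /q; ring.
  by rewrite exprS ler_wpM2r// sqr_ge0.
have T3 : A ^+ 2 * r * M ^+ 2 <= 1 / 25.
  apply: le_trans qg2.
  apply: (@le_trans _ _ (A ^+ 2 * (K * h) * M ^+ 2)).
    by rewrite ler_wpM2r ?sqr_ge0// ler_wpM2l// sqr_ge0.
  rewrite (_ : _ * M ^+ 2 = A * q * (h * M ^+ 2)); last by rewrite /q; ring.
  have Aqq : A * q <= q ^+ 2 by rewrite expr2 ler_wpM2r.
  by apply: ler_pM => //; rewrite mulr_ge0 ?sqr_ge0.
have T4 : A ^+ 2 * e * M ^+ 2 <= (1 / 25) * c.
  apply: (@le_trans _ _ (q ^+ 2 * g * c)); last by rewrite ler_wpM2r.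
  apply: (@le_trans _ _ (A ^+ 2 * h ^+ 2 * M ^+ 2)).
    by rewrite ler_wpM2r ?sqr_ge0// ler_wpM2l// sqr_ge0.
  rewrite (_ : _ * M ^+ 2 = A ^+ 2 * (h * M ^+ 2) * h); last by ring.
  have A2q : A ^+ 2 <= q ^+ 2 by rewrite lerXn2r ?nnegrE.
  have hM0 : 0 <= h * M ^+ 2 by rewrite mulr_ge0 ?sqr_ge0.
  have AhM : A ^+ 2 * (h * M ^+ 2) <= q ^+ 2 * g by rewrite ler_pM ?sqr_ge0.
  apply: ler_pM => //; last exact: le_trans hg g4.
  by rewrite mulr_ge0 ?sqr_ge0.
have U2 : U <= 3 / 100.
  have : q * g * c <= 1 / 80 * c by rewrite ler_wpM2r.
  have -> : U = 2 * (A * r) + A * e by rewrite /U -/A; ring.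
  move: Ar Ae qg1 c1; set Ar := A * r; set Ae := A * e; set qg := q * g.
  lra.
split; last 1 first.
- have U0 : 0 <= U by rewrite mulr_ge0// addr_ge0// mulr_ge0.
  rewrite -/A.
  have -> : 2 * U * A ^+ 2 * kappa =
      4 * (A ^+ 3 * kappa * r) + 2 * (A ^+ 3 * kappa * e).
    by rewrite /U -/A; ring.
  have -> : (1 + U) / 2 * A ^+ 2 * (4 * r + e) * M ^+ 2 =
      (1 + U) / 2 * (4 * (A ^+ 2 * r * M ^+ 2) + A ^+ 2 * e * M ^+ 2) by ring.
  apply: (@le_trans _ _ (4 * (1 / 10) + 2 * (1 / 10 * c) +
    (1 + 3 / 100) / 2 * (4 * (1 / 25) + 1 / 25 * c))); last lra.
  apply: lerD; first lra.
  apply: ler_pM; [by rewrite divr_ge0// addr_ge0| |lra|lra].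
  have T30 : 0 <= A ^+ 2 * r * M ^+ 2.
    by rewrite mulr_ge0 ?sqr_ge0// mulr_ge0 ?sqr_ge0.
  have T40 : 0 <= A ^+ 2 * e * M ^+ 2.
    by rewrite mulr_ge0 ?sqr_ge0// mulr_ge0 ?sqr_ge0.
  by rewrite addr_ge0 // mulr_ge0.
- apply: le_lt_trans rK _.
  apply: (@le_lt_trans _ _ ((M + 3 / 2 * X) * h)); first by rewrite ler_wpM2r.
  have MM : M * h <= g.
    by apply: le_trans hM2; rewrite mulrC ler_wpM2l// expr2 ler_peMr// ltW.
  have : X * h <= q * g by rewrite ler_pM// ltW.
  rewrite mulrDl -[3 / 2 * X * h]mulrA; lra.
- lra.
Qed.

(** With w = sqrt n and s the optimal Chernoff exponent, the cubic error
    n * s^3 of [iid_mean_tail] is at most 1/10. *)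
Lemma linear_error_le (R : realType) (y w C : R) (s := Num.sqrt (2 * y) / w) :
  0 <= y -> 100 <= C -> C * expR y <= w ->
  2 * s <= 1 /\ w ^+ 2 * s ^+ 3 <= 10^-1.
Proof.
move=> y0 C1 Cyw; set v := Num.sqrt (2 * y) in s *.
have v0 : 0 <= v := sqrtr_ge0 _.
have v2 : v ^+ 2 = 2 * y by rewrite sqr_sqrtr// mulr_ge0.
have ey : 0 < expR y := expR_gt0 y.
have yw : 100 * expR y <= w by apply: le_trans Cyw; rewrite ler_wpM2r// ltW.
have w0 : 0 < w by move: ey yw; set E := expR y; lra.
have ey2 : 1 + y + y ^+ 2 / 4 <= expR y.
  have -> : expR y = expR (y / 2) ^+ 2.
    by rewrite -expRM_natl; congr expR; field.
  have -> : 1 + y + y ^+ 2 / 4 = (1 + y / 2) ^+ 2 by field.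
  by rewrite lerXn2r ?nnegrE ?expR_ge0 ?expR_ge1Dx// addr_ge0 ?divr_ge0.
have vy : v <= (1 + 2 * y) / 2.
  rewrite -v2 -subr_ge0 (_ : _ - _ = (1 - v) ^+ 2 / 2); last by field.
  by rewrite divr_ge0 ?sqr_ge0.
have y2 : 0 <= y ^+ 2 by exact: sqr_ge0.
split.
  rewrite /s mulrA ler_pdivrMr// mul1r; lra.
rewrite (_ : _ * _ = v ^+ 3 / w); last by rewrite /s; field; rewrite gt_eqF.
rewrite ler_pdivrMr// exprSr v2.
have : 2 * y * v <= 2 * y * ((1 + 2 * y) / 2) by rewrite ler_wpM2l// mulr_ge0.
have -> : 2 * y * ((1 + 2 * y) / 2) = y + 2 * y ^+ 2 by field.
lra.
Qed.

Lemma delta_split (R : realType) (delta : R) : 0 <= delta ->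
  delta / 4 * expR 2^-1 + delta / 2 * expR 10^-1 <= delta.
Proof.
move=> d0.
have h1 : `|2^-1 : R| <= 1 by rewrite ger0_norm; lra.
have h2 : `|10^-1 : R| <= 1 by rewrite ger0_norm; lra.
have := expR_le_quadratic h1; have := expR_le_quadratic h2.
rewrite !ger0_norm; [|lra|lra].
set a := expR _; set b := expR _ => Ha Hb.
rewrite (_ : _ + _ = delta * (b / 4 + a / 2)); last by field.
by rewrite ler_piMr//; lra.
Qed.

(** * The mass of the good samples *)

Section good_samples.
Context (R : realType) (I : finType) (p : I -> R) (pmin delta : R) (n : nat).
Hypotheses (pmin_gt0 : 0 < pmin) (pmin_le : forall i, pmin <= p i).
Hypotheses (p1 : \sum_i p i = 1).
Hypotheses (delta_gt0 : 0 < delta) (delta_lt1 : delta < 1).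
Hypothesis n_large : 10 ^+ 6 * #|I|%:R ^+ 2 / (pmin ^+ 3 * delta ^+ 2) <= n%:R.

(** The threshold for Pearson's statistic: n times the size of the ball. *)
Definition chi2_level (m : nat) : R := m%:R + 2 * ln (4 / delta)
  + 2 * Num.sqrt (m%:R * ln (4 / delta)).

Let kappa := chi2_level #|I|.
Let m : R := #|I|%:R.

Let p_ge0 i : 0 <= p i. Proof. exact: ltW (lt_le_trans pmin_gt0 _). Qed.

Let m_ge1 : 1 <= m.
Proof.
rewrite ler1n lt0n; apply/eqP => I0; have := p1.
rewrite big1 => [/eqP|i _]; last by have := fintype0 i I0.
by rewrite eq_sym oner_eq0.
Qed.

Let m_pmin_le1 : m * pmin <= 1.
Proof.
by rewrite -p1 mulr_natl -sumr_const; apply: ler_sum.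
Qed.

(* Once n is multiplied by pmin two factors pmin remain in the denominator;
   as m * pmin <= 1, each of them can be traded for a factor m. *)
Let n_pmin_large : 10 ^+ 6 * m ^+ 4 / delta ^+ 2 <= n%:R * pmin.
Proof.
apply: le_trans (ler_wpM2r (ltW pmin_gt0) n_large).
have -> : 10 ^+ 6 * m ^+ 2 / (pmin ^+ 3 * delta ^+ 2) * pmin =
   10 ^+ 6 * m ^+ 4 / delta ^+ 2 * (m * pmin) ^- 2.
  field; rewrite !gt_eqF// (lt_le_trans ltr01)//.
have mp0 : 0 < m * pmin by rewrite mulr_gt0// (lt_le_trans ltr01).
have A0 : 0 <= 10 ^+ 6 * m ^+ 4 / delta ^+ 2.
  by rewrite divr_ge0 ?sqr_ge0// mulr_ge0 ?exprn_ge0.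
by rewrite ler_peMr// invf_ge1 ?exprn_gt0// exprn_ile1// ltW.
Qed.

Let n_pmin_gt0 : 0 < n%:R * pmin.
Proof.
apply: lt_le_trans n_pmin_large.
by rewrite divr_gt0 ?mulr_gt0 ?exprn_gt0// (lt_le_trans ltr01).
Qed.

Let n_gt0 : (0 < n)%N.
Proof. by have := n_pmin_gt0; case: n => //; rewrite mul0r ltxx. Qed.

Let x : R := ln (4 / delta).
Let x_gt0 : 0 < x.
Proof.
by rewrite ln_gt0// ltr_pdivlMr// mul1r (lt_trans delta_lt1)// ltr1n.
Qed.

Let expNx : expR (- x) = delta / 4.
Proof. by rewrite expRN lnK ?invf_div// posrE divr_gt0. Qed.

Let X := Num.sqrt x. Let M := Num.sqrt m.
Let X2 : X ^+ 2 = x. Proof. by rewrite sqr_sqrtr ?(ltW x_gt0). Qed.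
Let M2 : M ^+ 2 = m. Proof. by rewrite sqr_sqrtr. Qed.

Let kappaE : kappa = M ^+ 2 + 2 * X ^+ 2 + 2 * (M * X).
Proof. by rewrite X2 M2 -sqrtrM. Qed.

Let e := (n%:R * pmin)^-1.

(* The constant 10^-3 * 4 = 1/250 absorbs the 4 in exp(- x) = delta / 4. *)
Let e_le : e <= ((10 ^+ 3)^-1 * 4 * expR (- X ^+ 2) / M ^+ 4) ^+ 2.
Proof.
have -> : M ^+ 4 = m ^+ 2 by rewrite -M2 -exprM.
rewrite X2 expNx /e.
have -> : ((10 ^+ 3)^-1 * 4 * (delta / 4) / m ^+ 2) ^+ 2 =
    (10 ^+ 6 * m ^+ 4 / delta ^+ 2)^-1 :> R.
  field; rewrite !gt_eqF// (lt_le_trans ltr01)//.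
rewrite lef_pV2 ?posrE//.
by rewrite divr_gt0 ?mulr_gt0 ?exprn_gt0// (lt_le_trans ltr01).
Qed.

Let chi2_bounds (r := Num.sqrt (kappa * e)) (U := X / M * (2 * r + e)) :
  [/\ r < 1, U <= 1 &
   2 * U * (X / M) ^+ 2 * kappa
     + (1 + U) / 2 * (X / M) ^+ 2 * (4 * r + e) * M ^+ 2 <= 2^-1].
Proof.
rewrite /U /r kappaE; apply: (@chi2_error_le R X M e ((10 ^+ 3)^-1 * 4)).
- by rewrite sqrtr_gt0.
- by rewrite -[leLHS]sqrtr1 ler_wsqrtr.
- by rewrite invr_ge0 ltW.
- by rewrite mulr_ge0// invr_ge0 exprn_ge0.
- by rewrite (_ : _ * 4 = 250^-1)//; field.
- exact: e_le.
Qed.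

Let kappa_ge0 : 0 <= kappa.
Proof.
by rewrite /kappa /chi2_level -/x !addr_ge0// mulr_ge0// ?sqrtr_ge0// ltW.
Qed.

(** A sample missing an atom j would have Pearson statistic at least n p_j, so
    below this level every atom is observed. *)
Lemma chi2_level_lt : kappa < n%:R * pmin.
Proof.
have [r1 _ _] := chi2_bounds.
rewrite -[ltRHS]mul1r -ltr_pdivrMr//; rewrite ltNge; apply/negP => k1.
by move: r1; rewrite ltNge -[leLHS]sqrtr1 ler_wsqrtr.
Qed.

Lemma chi2_tail_mass :
  \sum_(f : {ffun 'I_n -> I} |
     kappa < chi2_form p n%:R (\sum_k centered_unit p (f k)))
   \prod_k p (f k) <= delta / 4 * expR 2^-1.
Proof.
have [_ U1 err] := chi2_bounds.
have e0 : 0 <= e by rewrite invr_ge0 ltW.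
have := @iid_chi2_tail R I p pmin n X M (Num.sqrt (kappa * e)) e
  (X / M * (2 * Num.sqrt (kappa * e) + e)) pmin_gt0 pmin_le p1 n_gt0.
rewrite -kappaE expRD X2 expNx; apply => //.
- by rewrite sqrtr_gt0.
- by rewrite sqrtr_gt0 (lt_le_trans ltr01).
- by rewrite sqr_sqrtr// mulr_ge0.
Qed.

Lemma linear_tail_mass (g : I -> R) : (forall i, `|g i| <= 1) ->
  \sum_(f : {ffun 'I_n -> I} |
     Num.sqrt (2 * ln (2 / delta) * n%:R) < \sum_k (g (f k) - \sum_i p i * g i))
   \prod_k p (f k) <= delta / 2 * expR 10^-1.
Proof.
move=> g1; set mu := \sum_i p i * g i; set y := ln (2 / delta).
have y0 : 0 < y.
  by rewrite ln_gt0// ltr_pdivlMr// mul1r (lt_trans delta_lt1)// ltr1n.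
have expy : expR y = 2 / delta by rewrite lnK// posrE divr_gt0.
pose w : R := Num.sqrt n%:R.
have w2 : w ^+ 2 = n%:R by rewrite sqr_sqrtr.
have w0 : 0 < w by rewrite sqrtr_gt0 ltr0n.
have C100 : 100 <= 10 ^+ 3 / 2 :> R by rewrite !exprS expr0; lra.
have Cw : 10 ^+ 3 / 2 * expR y <= w.
  have Cy0 : 0 <= 10 ^+ 3 / 2 * expR y :> R.
    by rewrite mulr_ge0 ?expR_ge0// divr_ge0 ?exprn_ge0.
  rewrite -(@ler_pXn2r _ 2) ?nnegrE ?(ltW w0)//.
  have -> : (10 ^+ 3 / 2 * expR y) ^+ 2 = 10 ^+ 6 * 1 / delta ^+ 2.
    by rewrite expy; field; rewrite gt_eqF.
  rewrite w2; apply: (@le_trans _ _ (n%:R * pmin)).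
    apply: le_trans n_pmin_large; rewrite ler_wpM2r ?invr_ge0 ?sqr_ge0//.
    by rewrite ler_wpM2l ?exprn_ge0// exprn_ege1.
  by rewrite ler_piMr// (le_trans _ m_pmin_le1)// ler_peMl// ltW.
have [s1 ns] :=
  @linear_error_le R y w (10 ^+ 3 / 2) (ltW y0) C100 Cw.
set s := Num.sqrt (2 * y) / w in s1 ns.
have s0 : 0 <= s by rewrite divr_ge0 ?sqrtr_ge0// ltW.
have pg1 : `|mu| <= 1.
  rewrite -p1; apply: le_trans (ler_norm_sum _ _ _) _; apply: ler_sum => i _.
  by rewrite normrM ger0_norm// ler_piMr.
apply: le_trans (@iid_mean_tail R I p (fun i => g i - mu) n s _
  p_ge0 p1 _ _ _ s0 s1) _.
- move=> i; rewrite (le_trans (ler_normB _ _))//.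
  by rewrite [leRHS](_ : _ = 1 + 1)// lerD.
- rewrite (eq_bigr (fun i => p i * g i - p i * mu)) => [|i _];
    last by rewrite mulrBr.
  by rewrite sumrB -mulr_suml p1 mul1r subrr.
- rewrite (eq_bigr (fun i =>
      p i * g i ^+ 2 - 2 * mu * (p i * g i) + p i * mu ^+ 2)) => [|i _];
    last ring.
  rewrite big_split/= sumrB -mulr_suml p1 -mulr_sumr -/mu.
  have : \sum_i p i * g i ^+ 2 <= 1.
    rewrite -p1; apply: ler_sum => i _; rewrite ler_piMr//.
    by rewrite -real_normK ?num_real// exprn_ile1.
  have := sqr_ge0 mu; lra.
have v2 : Num.sqrt (2 * y) ^+ 2 = 2 * y by rewrite sqr_sqrtr// mulr_ge0// ltW.
have s2 : n%:R * s ^+ 2 = 2 * y.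
  by rewrite -w2 /s exprMn v2; field; rewrite gt_eqF.
have sT : s * Num.sqrt (2 * y * n%:R) = 2 * y.
  rewrite sqrtrM ?mulr_ge0 ?(ltW y0)// -/w -[RHS]v2 /s.
  by set v := Num.sqrt (2 * y); field; rewrite gt_eqF.
rewrite sT mulrDr mulrA s2 -w2.
have <- : expR (- y) = delta / 2 by rewrite expRN expy invf_div.
rewrite -expRD ler_expR; move: ns; set z := _ * _; lra.
Qed.

Lemma good_samples_mass (g : I -> R) : (forall i, `|g i| <= 1) ->
  1 - delta <= \sum_(f : {ffun 'I_n -> I} |
     (chi2_form p n%:R (\sum_k centered_unit p (f k)) <= kappa) &&
     (\sum_k (g (f k) - \sum_i p i * g i) <=
      Num.sqrt (2 * ln (2 / delta) * n%:R)))
   \prod_k p (f k).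
Proof.
move=> g1.
rewrite lerBlDr.
apply: le_trans (lerD (lexx _) (delta_split (ltW delta_gt0))).
apply: le_trans (lerD (lexx _) (lerD chi2_tail_mass (linear_tail_mass g1))).
have tot : \sum_(f : {ffun 'I_n -> I}) \prod_k p (f k) = 1.
  rewrite -(bigA_distr_bigA (fun _ => p)) /=.
  by rewrite big1// => i _; rewrite p1.
rewrite -[leLHS]tot [X in _ <= X + _]big_mkcond.
rewrite [X in _ <= _ + (X + _)]big_mkcond [X in _ <= _ + (_ + X)]big_mkcond.
rewrite -!big_split/=; apply: ler_sum => f _.
have pf0 : 0 <= \prod_k p (f k) by apply: prodr_ge0.
by rewrite !ltNge; case: (_ <= kappa); case: (_ <= Num.sqrt _) => /=; lra.
Qed.

End good_samples.

(** * Integration against finitely supported measures *)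

Lemma measurable_set1_Rvec (R : realType) (d : nat) (v : Rvec R d) :
  measurable [set v].
Proof.
rewrite -[X in measurable X]setCK; apply: measurableC.
apply: sub_sigma_algebra => /=; apply: closed_openC.
apply: (@accessible_closed_set1 'rV[R]_d).
exact: (hausdorff_accessible (@norm_hausdorff R 'rV[R]_d)).
Qed.

Section finitely_supported_measures.
Local Open Scope ereal_scope.

(** The integral of a nonnegative function is a supremum over the simple
    functions below it, hence monotone even without measurability. *)
Lemma ge0_le_integral_nonmeasurable d (T : measurableType d) (R : realType)
    (mu : {measure set T -> \bar R}) (f g : T -> \bar R) :
  (forall x, 0 <= f x) -> (forall x, f x <= g x) ->
  \int[mu]_x f x <= \int[mu]_x g x.
Proof.
move=> f0 fg; rewrite !ge0_integralTE//;
  last by move=> x; exact: le_trans (fg x).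
apply: ereal_sup_le => _ /= [h hf <-]; exists h => // x.
exact: le_trans (fg x).
Qed.

Lemma measurable_range_ord d (T : measurableType d) (m : nat)
    (zeta : 'I_m -> T) :
  (forall j, measurable [set zeta j]) -> measurable (range zeta).
Proof.
move=> mzeta.
have -> : range zeta = \bigcup_(j in [set: 'I_m]) [set zeta j].
  rewrite eqEsubset; split => x /=.
    by move=> [j _ <-]; exists j.
  by move=> [j _ ->]; exists j.
exact: fin_bigcup_measurable.
Qed.

Section finite_support.
Context d (T : measurableType d) (R : realType) (m : nat) (zeta : 'I_m -> T).
Context (mu : {measure set T -> \bar R}).
Hypothesis zeta_inj : injective zeta.
Hypothesis mzeta : forall j, measurable [set zeta j].
Hypothesis mu_supp : mu (~` range zeta) = 0.

Let mrange : measurable (range zeta) := measurable_range_ord mzeta.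

(** No measurability is required of [f]: it lies between two measurable
    functions that agree with it on the support, being 0 and +oo outside. *)
Lemma ge0_integral_finite_support (f : T -> \bar R) : (forall x, 0 <= f x) ->
  \int[mu]_x f x = \sum_j f (zeta j) * mu [set zeta j].
Proof.
move=> f0.
pose h (c : \bar R) x := \sum_j f (zeta j) * (\1_[set zeta j] x)%:E
  + c * (\1_(~` range zeta) x)%:E.
have mind (A : set T) : measurable A ->
    measurable_fun setT (EFin \o (\1_A : T -> R)).
  by move=> mA; apply/measurable_EFinP; exact: measurable_indic.
have ind0 (A : set T) x : 0 <= (\1_A x : R)%:E by rewrite lee_fin.
have int_ind k (A : set T) : measurable A -> 0 <= k ->
    \int[mu]_x (k * (\1_A x)%:E) = k * mu A.
  move=> mA k0; rewrite ge0_integralZl//; last exact: mind.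
  by rewrite integral_indic// setIT.
have mout : measurable (~` range zeta) by exact: measurableC.
have h_int c : 0 <= c -> \int[mu]_x h c x = \sum_j f (zeta j) * mu [set zeta j].
  move=> c0; rewrite ge0_integralD//.
  - rewrite ge0_integral_sum//; first last.
    + by move=> j x _; rewrite mule_ge0.
    + by move=> j; apply: measurable_funeM; exact: mind.
    rewrite int_ind// mu_supp mule0 adde0; apply: eq_bigr => j _.
    by rewrite int_ind.
  - by move=> x _; apply: sume_ge0 => j _; rewrite mule_ge0.
  - apply: emeasurable_sum => j; apply: measurable_funeM; exact: mind.
  - by move=> x _; rewrite mule_ge0.
  - by apply: measurable_funeM; exact: mind.
have h_zeta c j : h c (zeta j) = f (zeta j).
  rewrite /h (bigD1 j)//= !indicE mem_set// mule1 big1 ?adde0; last first.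
    move=> i ij; rewrite indicE memNset ?mule0//= => /zeta_inj ji.
    by rewrite ji eqxx in ij.
  by rewrite memNset ?mule0 ?adde0//= => nr; apply: nr; exists j.
have h_out c x : ~ range zeta x -> h c x = c.
  move=> nx; rewrite /h big1 ?add0e; last first.
    by move=> i _; rewrite indicE memNset ?mule0//= => xi; apply: nx; exists i.
  by rewrite indicE mem_set// mule1.
have h0 c x : 0 <= c -> 0 <= h c x.
  have [[j _ <-]|nx] := pselect (range zeta x); first by rewrite h_zeta.
  by rewrite h_out.
apply/eqP; rewrite eq_le; apply/andP; split.
  rewrite -(h_int +oo)//; apply: ge0_le_integral_nonmeasurable => // x.
  have [[j _ <-]|nx] := pselect (range zeta x); first by rewrite h_zeta.
  by rewrite h_out// leey.
rewrite -(h_int 0)//; apply: ge0_le_integral_nonmeasurable => // x.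
  exact: h0.
have [[j _ <-]|nx] := pselect (range zeta x); first by rewrite h_zeta.
by rewrite h_out.
Qed.

Lemma integral_finite_support (f : T -> R) :
    (forall j, mu [set zeta j] \is a fin_num) ->
  \int[mu]_x (f x)%:E = (\sum_j f (zeta j) * fine (mu [set zeta j]))%:E.
Proof.
move=> mufin; rewrite integralE !ge0_integral_finite_support//.
rewrite -sumEFin.
pose u j := fine (mu [set zeta j]).
have uE j : mu [set zeta j] = (u j)%:E by rewrite fineK.
under eq_bigr do rewrite uE funeposE -EFin_max -EFinM.
under [X in _ - X]eq_bigr do rewrite uE funenegE -EFinN -EFin_max -EFinM.
rewrite !sumEFin -EFinB -sumrB; congr EFin; apply: eq_bigr => j _.
rewrite -mulrBl; congr (_ * _)%R.
rewrite /Num.max; do 2 case: ltP => ?; lra.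
Qed.

(** On null atoms [f] may be negative; this is the case of the integrand of the
    chi-square divergence, as a Radon-Nikodym derivative is only almost
    everywhere nonnegative. *)
Lemma integral_finite_support_ge0 (f : T -> \bar R) :
  (forall j, mu [set zeta j] != 0 -> 0 <= f (zeta j)) ->
  \int[mu]_x f x = \sum_j f (zeta j) * mu [set zeta j].
Proof.
move=> f0; rewrite integralE !ge0_integral_finite_support//.
rewrite [X in _ - X]big1 ?sube0.
  apply: eq_bigr => j _; have [->|/f0 fj] := eqVneq (mu [set zeta j]) 0.
    by rewrite !mule0.
  by rewrite funeposE; move/max_idPl: fj => ->.
move=> j _; have [->|/f0 fj] := eqVneq (mu [set zeta j]) 0.
  by rewrite mule0.
rewrite funenegE (_ : maxe _ _ = 0) ?mul0e//; apply/max_idPr.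
by rewrite leeNl oppe0.
Qed.

Lemma finite_support_mass :
  (forall j, mu [set zeta j] \is a fin_num) ->
  mu setT = (\sum_j fine (mu [set zeta j]))%:E.
Proof.
move=> mufin; rewrite -[LHS]mul1e -integral_cst//.
rewrite (integral_finite_support (cst 1%R))//.
by under eq_bigr do rewrite mul1r.
Qed.

End finite_support.

(** * The chi-square divergence on atoms *)

Section chi2_finite.
Context d (T : measurableType d) (R : realType) (m : nat) (zeta : 'I_m -> T).
Context (mu : {finite_measure set T -> \bar R}) (Q : probability T R).
Hypothesis zeta_inj : injective zeta.
Hypothesis mzeta : forall j, measurable [set zeta j].
Hypothesis mu_supp : mu (~` range zeta) = 0.
Hypothesis Q_dom : Q `<< mu.

Let u j : R := fine (mu [set zeta j]).
Let q j : R := fine (Q [set zeta j]).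

Let uE j : mu [set zeta j] = (u j)%:E.
Proof. by rewrite fineK// fin_num_measure. Qed.

Let qE j : Q [set zeta j] = (q j)%:E.
Proof. by rewrite fineK// fin_num_measure. Qed.

Let u_ge0 j : (0 <= u j)%R. Proof. by rewrite fine_ge0. Qed.
Let q_ge0 j : (0 <= q j)%R. Proof. by rewrite fine_ge0. Qed.

Let dens x : R := fine (Radon_Nikodym (charge_of_finite_measure Q) mu x).

Lemma density_atom j : (dens (zeta j) * u j = q j)%R.
Proof.
apply: EFin_inj; rewrite EFinM -qE -uE.
have -> : Q [set zeta j] = \int[mu]_(x in [set zeta j])
    Radon_Nikodym (charge_of_finite_measure Q) mu x.
  by rewrite -Radon_Nikodym_integral.
rewrite (@eq_integral _ _ _ _ _ (cst (dens (zeta j))%:E)).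
  by rewrite integral_cst.
move=> x; rewrite inE => ->; rewrite /= /dens fineK//.
exact: Radon_Nikodym_fin_num.
Qed.

(** The value +oo arises exactly at the atoms that [mu] charges and [Q] does
    not; with 0 / 0 = 0 the formula also holds at atoms that neither
    charges. *)
Lemma chi2_term j : chi2_integrand (dens (zeta j)) * mu [set zeta j] =
  if (q j == 0)%R && (u j != 0)%R then +oo else ((q j - u j) ^+ 2 / q j)%:E.
Proof.
have qu := density_atom j; rewrite uE.
have [u0|u0] /= := eqVneq (u j) 0%R.
  by rewrite andbF -qu u0 mule0 mulr0 invr0 mulr0.
have up : (0 < u j)%R by rewrite lt_neqAle eq_sym u0 u_ge0.
rewrite /chi2_integrand andbT -qu mulf_eq0 (negbTE u0) orbF.
have [_|r0] := eqVneq (dens (zeta j)) 0%R; first by rewrite gt0_mulye// lte_fin.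
rewrite -EFinM; congr EFin; field.
by rewrite r0 u0.
Qed.

Lemma chi2_term_ge0 j : 0 <= chi2_integrand (dens (zeta j)) * mu [set zeta j].
Proof.
rewrite chi2_term; case: ifPn => // _.
by rewrite lee_fin divr_ge0 ?sqr_ge0.
Qed.

Lemma chi2_div_finite : chi2_div Q mu =
  \sum_j chi2_integrand (dens (zeta j)) * mu [set zeta j].
Proof.
rewrite /chi2_div (@integral_finite_support_ge0 _ _ _ _ zeta)// => j mu0.
rewrite -/(dens _) /chi2_integrand; case: ifPn => // r0.
rewrite lee_fin divr_ge0 ?sqr_ge0//.
have up : (0 < u j)%R by rewrite lt_neqAle u_ge0 eq_sym -eqe -uE mu0.
by rewrite -(pmulr_lge0 _ up) density_atom.
Qed.

Lemma chi2_div_le (eta : R) : chi2_div Q mu <= eta%:E ->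
  (forall j, q j = 0 -> u j = 0)%R /\
  (\sum_j (q j - u j) ^+ 2 / q j <= eta)%R.
Proof.
rewrite chi2_div_finite => le.
have qu j : (q j = 0 -> u j = 0)%R.
  move=> q0; apply/eqP; apply: contraT => u0.
  have : +oo <= eta%:E :> \bar R; last by [].
  apply: le_trans le; rewrite (bigD1 j)//= chi2_term q0 eqxx u0/=.
  rewrite addye// gt_eqF// (lt_le_trans ltNy0)// sume_ge0// => i _.
  exact: chi2_term_ge0.
split=> //; rewrite -lee_fin -sumEFin; apply: le_trans le.
apply: lee_sum => j _; rewrite chi2_term; case: ifPn => // /andP[/eqP/qu ->].
by rewrite eqxx.
Qed.

Lemma chi2_div_posE : (forall j, q j != 0%R) ->
  chi2_div Q mu = (\sum_j (q j - u j) ^+ 2 / q j)%:E.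
Proof.
move=> q0; rewrite chi2_div_finite -sumEFin; apply: eq_bigr => j _.
by rewrite chi2_term (negbTE (q0 j)).
Qed.

End chi2_finite.

End finitely_supported_measures.

(** * The deterministic argument *)

(** Cauchy-Schwarz, through the termwise inequality
    2 |q - u| <= (q - u)^2 / (t q) + t q with t = sqrt eta. *)
Lemma sum_abs_le_sqrt (R : realType) (I : finType) (q u : I -> R) (eta : R) :
  (forall j, 0 <= q j) -> (forall j, q j = 0 -> u j = 0) -> \sum_j q j = 1 ->
  0 < eta ->
  \sum_j (q j - u j) ^+ 2 / q j <= eta ->
  \sum_j `|q j - u j| <= Num.sqrt eta.
Proof.
move=> q0 qu q1 e0 le; set t := Num.sqrt eta.
have t0 : 0 < t by rewrite sqrtr_gt0.
have t2 : t ^+ 2 = eta by rewrite sqr_sqrtr// ltW.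
apply: (@le_trans _ _
  (\sum_j ((2 * t)^-1 * ((q j - u j) ^+ 2 / q j) + t / 2 * q j))).
  apply: ler_sum => j _; have [qj|qj] := eqVneq (q j) 0.
    by rewrite qj (qu _ qj) subrr normr0 invr0 !mulr0 addr0.
  have qp : 0 < q j by rewrite lt_neqAle eq_sym qj q0.
  rewrite -subr_ge0.
  have -> : (q j - u j) ^+ 2 = `|q j - u j| ^+ 2.
    by rewrite real_normK ?num_real.
  set a := `|_|.
  rewrite (_ : _ - a = (a - t * q j) ^+ 2 / (2 * t * q j)); last first.
    by field; rewrite qj gt_eqF.
  by rewrite divr_ge0 ?sqr_ge0// ?mulr_ge0// ltW.
rewrite big_split/= -!mulr_sumr q1.
apply: (@le_trans _ _ ((2 * t)^-1 * eta + t / 2 * 1)).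
  by rewrite lerD2r ler_wpM2l// invr_ge0 mulr_ge0// ltW.
by rewrite -t2 le_eqVlt; apply/orP; left; apply/eqP; field; rewrite gt_eqF.
Qed.

Section empirical_sample.
Context dT (T : measurableType dT) (R : realType) (m n : nat).
Context (zeta : 'I_m -> T).
Hypothesis zeta_inj : injective zeta.
Context (s : {ffun 'I_n -> 'I_m}) (z : 'I_n -> T).
Hypothesis zs : forall k, z k = zeta (s k).

(** The empirical frequency of the atom [j] in the sample [s]. *)
Definition frequency (j : 'I_m) : R := n%:R^-1 * \sum_k (j == s k)%:R.

Lemma empirical_atom j : empirical R z [set zeta j] = (frequency j)%:E.
Proof.
rewrite /empirical /frequency EFinM -sumEFin; congr (_ * _)%E.
apply: eq_bigr => k _; rewrite diracE zs; congr (_%:R%:E).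
have [->|jk] := eqVneq j (s k); first by rewrite mem_set.
by rewrite memNset//= => /zeta_inj kj; rewrite kj eqxx in jk.
Qed.

Lemma empirical_supp : empirical R z (~` range zeta) = 0%E.
Proof.
rewrite /empirical big1 ?mule0// => k _; rewrite diracE zs memNset//= => h.
by apply: h; exists (s k).
Qed.

Lemma chi2_form_frequency (p : 'I_m -> R) : (0 < n)%N -> (forall j, p j != 0) ->
  chi2_form p n%:R (\sum_k centered_unit p (s k)) =
  n%:R * \sum_j (p j - frequency j) ^+ 2 / p j.
Proof.
move=> n0 p0; rewrite /chi2_form !mulr_sumr; apply: eq_bigr => j _.
have -> : (\sum_k centered_unit p (s k)) j = n%:R * (frequency j - p j).
  rewrite sum_ffunE; under eq_bigr do rewrite ffunE.
  rewrite sumrB sumr_const card_ord mulrBr /frequency mulrA.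
  rewrite divff ?mul1r ?mulr_natl//.
  by rewrite pnatr_eq0 -lt0n.
have pj := p0 j; field.
by rewrite pj pnatr_eq0 -lt0n n0.
Qed.

Lemma sum_frequency (g : 'I_m -> R) :
  \sum_j g j * frequency j = n%:R^-1 * \sum_k g (s k).
Proof.
rewrite /frequency; under eq_bigr do rewrite mulrCA mulr_sumr.
rewrite -mulr_sumr exchange_big/=; congr (_ * _); apply: eq_bigr => k _.
rewrite (bigD1 (s k))//= eqxx mulr1 big1 ?addr0// => j /negbTE ->.
by rewrite mulr0.
Qed.

End empirical_sample.

Section deterministic.
Context dT (T : measurableType dT) (R : realType) (m n : nat).
Context (zeta : 'I_m -> T) (P : probability T R) (p : 'I_m -> R).
Context (s : {ffun 'I_n -> 'I_m}) (z : 'I_n -> T).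
Hypothesis Pdiscrete : is_discrete P zeta p.
Hypothesis mzeta : forall j, measurable [set zeta j].
Hypothesis zs : forall k, z k = zeta (s k).
Local Notation u := (frequency R s).

Let zeta_inj : injective zeta. Proof. by case: Pdiscrete. Qed.

Let P_supp : P (~` range zeta) = 0%E.
Proof.
case: Pdiscrete => _ _ P1; rewrite probability_setC ?P1 ?subee//.
exact: measurable_range_ord.
Qed.

Lemma expectation_discrete (Q : probability T R) (f : T -> R) :
  Q (~` range zeta) = 0%E ->
  'E_Q[f]%E = (\sum_j f (zeta j) * fine (Q [set zeta j]))%:E.
Proof.
move=> Qs; rewrite unlock; apply: integral_finite_support => // j.
exact: fin_num_measure.
Qed.

Lemma sum_discrete (Q : probability T R) : Q (~` range zeta) = 0%E ->
  \sum_j fine (Q [set zeta j]) = 1.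
Proof.
move=> Qs; apply: EFin_inj; rewrite -(@finite_support_mass _ _ _ _ zeta)//.
  exact: probability_setT.
by move=> j; exact: fin_num_measure.
Qed.

Lemma sum_weights : \sum_j p j = 1.
Proof.
rewrite -(sum_discrete P_supp); apply: eq_bigr => j _.
by case: Pdiscrete => _ -> _.
Qed.

Lemma expectation_weights (f : T -> R) :
  'E_P[f]%E = (\sum_j f (zeta j) * p j)%:E.
Proof.
rewrite expectation_discrete//; congr EFin; apply: eq_bigr => j _.
by case: Pdiscrete => _ -> _.
Qed.

Lemma dominated_supp (Q : probability T R) : Q `<< empirical R z ->
  Q (~` range zeta) = 0%E.
Proof.
move=> /null_content_dominatesP; apply;
  last exact: (@empirical_supp _ _ R _ _ zeta s).
by apply: measurableC; exact: measurable_range_ord.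
Qed.

(** Absolute continuity of [P] requires that every atom be observed. *)
Lemma true_in_ball (eta : R) : (forall j, 0 < p j) -> (forall j, 0 < u j) ->
  \sum_j (p j - u j) ^+ 2 / p j <= eta ->
  chi2_ball (empirical R z) eta P.
Proof.
move=> p0 u0 le.
have es := @empirical_supp _ _ R _ _ zeta s z zs.
have ea := @empirical_atom _ _ R _ _ zeta zeta_inj s z zs.
have dom : P `<< empirical R z.
  apply/null_content_dominatesP => A mA eA0.
  apply/eqP; rewrite -measure_le0 -P_supp; apply: le_measure; rewrite ?inE//.
    by apply: measurableC; exact: measurable_range_ord.
  move=> x Ax [j _ jx].
  have : (empirical R z [set zeta j] <= empirical R z A)%E.
    by apply: le_measure; rewrite ?inE// => _ ->; rewrite jx.
  by rewrite ea eA0 lee_fin leNgt u0.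
have Pp j : fine (P [set zeta j]) = p j by case: Pdiscrete => _ -> _.
split=> //; rewrite (@chi2_div_posE _ _ _ _ zeta)//; last first.
  by move=> j; rewrite Pp gt_eqF.
rewrite lee_fin; apply: le_trans le; apply: ler_sum => j _.
by rewrite Pp [X in (_ - X) ^+ 2](congr1 fine (ea j) : _ = u j).
Qed.

Lemma ball_expectation_le (eta L : R) (f : T -> R) (Q : probability T R) :
  0 < eta -> 0 <= L -> (forall j, `|f (zeta j)| <= L) ->
  chi2_ball (empirical R z) eta Q ->
  ('E_Q[f] <= (\sum_j f (zeta j) * u j + L * Num.sqrt eta)%:E)%E.
Proof.
move=> eta0 L0 fL [Qdom Qchi].
have es := @empirical_supp _ _ R _ _ zeta s z zs.
have ea := @empirical_atom _ _ R _ _ zeta zeta_inj s z zs.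
have Qs := dominated_supp Qdom.
have [qu] := @chi2_div_le _ _ _ _ zeta (empirical R z) Q zeta_inj mzeta es
  Qdom eta Qchi.
set q := fun j => fine (Q [set zeta j]).
under eq_bigr do rewrite [X in (_ - X) ^+ 2](congr1 fine (ea _) : _ = u _).
rewrite -/q.
move=> le.
rewrite expectation_discrete// lee_fin -lerBlDl -sumrB.
have tv : \sum_j `|q j - u j| <= Num.sqrt eta.
  apply: sum_abs_le_sqrt => //.
  - by move=> j; rewrite fine_ge0.
  - by move=> j /qu; rewrite (congr1 fine (ea _) : _ = u _).
  - exact: sum_discrete.
apply: le_trans (ler_wpM2l L0 tv); rewrite mulr_sumr; apply: ler_sum => j _.
rewrite -mulrBr; apply: le_trans (ler_norm _) _.
by rewrite normrM ler_wpM2r.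
Qed.

(** The excess risk bound at one sample, given that Pearson's statistic and the
    deviation of the empirical risk of [fstar] are controlled. *)
Lemma dro_excess_risk_le (F : Type) (loss : F -> T -> R) (fstar fdro : F)
    (eta L t : R) :
  (forall j, 0 < p j) -> (forall j, 0 < u j) ->
  \sum_j (p j - u j) ^+ 2 / p j <= eta ->
  0 < eta -> 0 <= L -> (forall j, `|loss fstar (zeta j)| <= L) ->
  \sum_j loss fstar (zeta j) * u j - \sum_j loss fstar (zeta j) * p j <= t ->
  is_argmin (fun f => worst_case_risk (empirical R z) eta (loss f)) fdro ->
  ('E_P[loss fdro] - 'E_P[loss fstar] <= (L * Num.sqrt eta + t)%:E)%E.
Proof.
move=> p0 u0 chi eta0 L0 fL lin argmin.
have Pb := true_in_ball p0 u0 chi.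
have : ('E_P[loss fdro] <=
    (\sum_j loss fstar (zeta j) * u j + L * Num.sqrt eta)%:E)%E.
  apply: (@le_trans _ _ (worst_case_risk (empirical R z) eta (loss fdro))).
    by apply: ereal_sup_ubound; exists P.
  apply: le_trans (argmin fstar) _.
  apply: ge_ereal_sup => _ [Q Qb <-].
  exact: ball_expectation_le.
rewrite !expectation_weights -EFinB !lee_fin; lra.
Qed.

End deterministic.

(** * From samples of indices to the probability space *)

Section iid_discrete.
Context dO (Omega : measurableType dO) dT (T : measurableType dT).
Context (R : realType).
Context (Pr : probability Omega R) (P : probability T R).
Context (m n : nat) (zeta : 'I_m -> T) (p : 'I_m -> R).
Context (z : 'I_n -> {RV Pr >-> T}).
Hypothesis Pdiscrete : is_discrete P zeta p.
Hypothesis mzeta : forall j, measurable [set zeta j].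
Hypothesis z_iid : iid_sample z P.

(** The event that the observations are the atoms with indices [s]. *)
Definition cylinder (s : {ffun 'I_n -> 'I_m}) : set Omega :=
  \bigcap_(k in [set` [set: 'I_n]%SET]) (z k @^-1` [set zeta (s k)]).

Lemma measurable_cylinder s : measurable (cylinder s).
Proof.
apply: fin_bigcap_measurable; first exact: finite_finset.
by move=> k _; apply: measurable_funPTI.
Qed.

Lemma cylinder_mass s : Pr (cylinder s) = (\prod_k p (s k))%:E.
Proof.
case: z_iid => indep law.
rewrite /cylinder (indep [set: 'I_n]%SET (fun k => [set zeta (s k)]))//.
rewrite -prodEFin big_mkcond/=; apply: eq_bigr => k _.
rewrite inE; have := law k [set zeta (s k)] (mzeta _).
by case: Pdiscrete => _ -> _.
Qed.

Lemma trivIset_cylinder (A : set {ffun 'I_n -> 'I_m}) : trivIset A cylinder.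
Proof.
apply/trivIsetP => s t _ _ st; rewrite -subset0 => w [sw tw].
move/eqP: st; apply.
apply/ffunP => k; case: Pdiscrete => zeta_inj _ _; apply: zeta_inj.
have kT : [set` [set: 'I_n]%SET] k by rewrite /= inE.
by rewrite -(sw k kT) (tw k kT).
Qed.

Lemma iid_event_ge (good : pred {ffun 'I_n -> 'I_m}) (event : set Omega) :
  measurable event ->
  (forall s w, good s -> (forall k, z k w = zeta (s k)) -> event w) ->
  ((\sum_(s | good s) \prod_k p (s k))%:E <= Pr event)%E.
Proof.
move=> mev good_ev.
have fin : finite_set [set` good] by exact: finite_finset.
have mU : measurable (\bigcup_(s in [set` good]) cylinder s).
  by apply: fin_bigcup_measurable => // s _; exact: measurable_cylinder.
have -> : (\sum_(s | good s) \prod_k p (s k))%:E =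
    Pr (\bigcup_(s in [set` good]) cylinder s).
  rewrite measure_fin_bigcup//; last by move=> s _; exact: measurable_cylinder.
    rewrite -(bigfs _ (index_enum_uniq _)); last first.
      by move=> s _; rewrite mem_index_enum.
    rewrite -sumEFin; apply: eq_bigr => s _; exact/esym/cylinder_mass.
  exact: trivIset_cylinder.
apply: le_measure; rewrite ?inE// => w [s gs sw].
by apply: (good_ev s) => // k; apply: sw; rewrite /= inE.
Qed.

End iid_discrete.

(** * The excess risk bound *)

Theorem theorem5p2 (R : realType) (d : nat) (Z : set (Rvec R d))
    (P : probability (Rvec R d) R)
    (m : nat) (zeta : 'I_m -> Rvec R d) (p : 'I_m -> R)
    (zetaZ : forall i, Z (zeta i))
    (Pdiscrete : is_discrete P zeta p)
    (pmin_gt0 : 0 < min_prob p)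
    (F : Type) (loss : F -> Rvec R d -> R)
    (fstar : F)
    (fstar_min : is_argmin (fun f => 'E_P[loss f]%E) fstar)
    (fstar_bounded : (sup_norm Z (loss fstar) < +oo)%E)
    (delta : R) (delta_gt0 : 0 < delta) (delta_lt1 : delta < 1)
    (n : nat)
    (n_large :
      10 ^+ 6 * m%:R ^+ 2 / (min_prob p ^+ 3 * delta ^+ 2) <= n%:R)
    (dOmega : measure_display) (Omega : measurableType dOmega)
    (Pr : probability Omega R)
    (z : 'I_n -> {RV Pr >-> Rvec R d})
    (zZ : forall i omega, Z (z i omega))
    (z_iid : iid_sample z P)
    (fdro : Omega -> F) :
  let kappa := m%:R + 2 * ln (4 / delta)
                 + 2 * Num.sqrt (m%:R * ln (4 / delta)) in
  let eta := n%:R^-1 * kappa in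
  (forall omega,
    is_argmin
      (fun f => worst_case_risk (empirical R (fun i => z i omega)) eta (loss f))
      (fdro omega)) ->
  let event := [set omega |
    ('E_P[loss (fdro omega)] - 'E_P[loss fstar] <=
     sup_norm Z (loss fstar) *
       ((Num.sqrt n%:R)^-1 * Num.sqrt kappa
        + Num.sqrt (2 * ln (2 / delta) / n%:R))%:E)%E] in
  measurable event ->
  ((1 - delta)%:E <= Pr event)%E.
Proof.
move=> kappa eta fdro_min event mevent.
have mzeta j : measurable [set zeta j] by exact: measurable_set1_Rvec.
have p1 := sum_weights Pdiscrete mzeta.
set pmin := min_prob p in pmin_gt0 n_large.
have pmin_le j : pmin <= p j by exact: Order.TotalTheory.bigmin_le.
have p_gt0 j : 0 < p j := lt_le_trans pmin_gt0 (pmin_le j).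
have p_ge0 j := ltW (p_gt0 j).
have n_large' : 10 ^+ 6 * #|'I_m|%:R ^+ 2 / (pmin ^+ 3 * delta ^+ 2) <= n%:R.
  by rewrite card_ord.
have kappa_lt : kappa < n%:R * pmin.
  have := chi2_level_lt pmin_gt0 pmin_le p1 delta_gt0 delta_lt1 n_large'.
  by rewrite card_ord.
have m_gt0 : (0 < m)%N.
  rewrite lt0n; apply/eqP => m0; have := p1.
  rewrite big1 => [/eqP|[i im] _]; first by rewrite eq_sym oner_eq0.
  by exfalso; rewrite m0 in im.
pose j0 := Ordinal m_gt0.
have x0 : 0 < ln (4 / delta).
  by rewrite ln_gt0// ltr_pdivlMr// mul1r (lt_trans delta_lt1)// ltr1n.
have kappa_gt0 : 0 < kappa.
  by rewrite /kappa ltr_wpDr ?mulr_ge0 ?sqrtr_ge0// ltr_wpDl// mulr_gt0.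
have n_gt0 : (0 < n)%N.
  by move: (lt_trans kappa_gt0 kappa_lt); case: (n) => //; rewrite mul0r ltxx.
have N0 : 0 < n%:R :> R by rewrite ltr0n.
have eta_gt0 : 0 < eta by rewrite mulr_gt0// invr_gt0.
pose L := fine (sup_norm Z (loss fstar)).
have le_sup j : (`|loss fstar (zeta j)|%:E <= sup_norm Z (loss fstar))%E.
  by apply: ereal_sup_ubound; exists (zeta j).
have supE : sup_norm Z (loss fstar) = L%:E.
  rewrite /L fineK// ge0_fin_numE//; apply: le_trans (le_sup j0).
  by rewrite lee_fin.
have loss_le j : `|loss fstar (zeta j)| <= L by rewrite -lee_fin -supE.
have L0 : 0 <= L by apply: le_trans (loss_le j0).
(* If L = 0 then g = 0 as x / 0 = 0, and the loss is still L * g. *)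
pose g j := loss fstar (zeta j) / L.
have gL j : loss fstar (zeta j) = L * g j.
  have [L00|Lneq] := eqVneq L 0; last by rewrite /g mulrCA divff ?mulr1.
  have := loss_le j; rewrite L00 mul0r normr_le0 => /eqP //.
have g1 j : `|g j| <= 1.
  have [L00|Lneq] := eqVneq L 0; first by rewrite /g L00 invr0 mulr0 normr0.
  rewrite /g normrM normfV (ger0_norm L0) ler_pdivrMr ?mul1r//.
  by rewrite lt_neqAle eq_sym Lneq.
have := good_samples_mass pmin_gt0 pmin_le p1 delta_gt0 delta_lt1 n_large' g1.
rewrite -lee_fin => /le_trans; apply.
apply: (iid_event_ge Pdiscrete mzeta z_iid mevent).
move=> s w /andP[chi lin] zs; rewrite /event /= supE -EFinM.
set u := frequency R s.
have chi' : \sum_j (p j - u j) ^+ 2 / p j <= eta.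
  move: chi; rewrite chi2_form_frequency// => [|j]; last by rewrite gt_eqF.
  rewrite -/u /chi2_level card_ord -/kappa => chi.
  by rewrite -(ler_pM2l N0) /eta mulrA divff ?gt_eqF// mul1r.
have u_gt0 j : 0 < u j.
  rewrite lt_neqAle; apply/andP; split; last first.
    by rewrite /u /frequency mulr_ge0 ?invr_ge0// sumr_ge0.
  apply/eqP => uj; have : p j <= eta.
    apply: le_trans chi'; rewrite (bigD1 j)//= -uj subr0 expr2 -mulrA.
    rewrite divff ?gt_eqF// mulr1 lerDl sumr_ge0// => i _.
    by rewrite divr_ge0 ?sqr_ge0.
  apply/negP; rewrite -ltNge; apply: lt_le_trans (pmin_le j).
  by rewrite /eta mulrC ltr_pdivrMr// mulrC.
have lin' : \sum_j loss fstar (zeta j) * u j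
    - \sum_j loss fstar (zeta j) * p j <=
    L * Num.sqrt (2 * ln (2 / delta) / n%:R).
  have -> : \sum_j loss fstar (zeta j) * u j = L * (n%:R^-1 * \sum_k g (s k)).
    rewrite -sum_frequency mulr_sumr; apply: eq_bigr => j _.
    by rewrite gL mulrA.
  have -> : \sum_j loss fstar (zeta j) * p j = L * \sum_j p j * g j.
    rewrite mulr_sumr; apply: eq_bigr => j _; rewrite gL; ring.
  rewrite -mulrBr ler_wpM2l//.
  move: lin; rewrite sumrB sumr_const card_ord -[_ *+ n]mulr_natl.
  set mu := \sum_i _; set S := \sum_k _; set y := 2 * ln _ => lin.
  rewrite -(ler_pM2l N0) mulrBr mulrA divff ?gt_eqF// mul1r.
  apply: le_trans lin _.
  have y0 : 0 <= y.
    rewrite mulr_ge0// ln_ge0// ler_pdivlMr// mul1r.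
    by rewrite (le_trans (ltW delta_lt1))// ler1n.
  rewrite sqrtrM// [in leRHS]sqrtrM// sqrtrV// mulrCA ler_wpM2l ?sqrtr_ge0//.
  rewrite -[X in X / _](@sqr_sqrtr _ n%:R)// expr2.
  by rewrite mulfK// gt_eqF// sqrtr_gt0.
have := dro_excess_risk_le Pdiscrete mzeta zs p_gt0 u_gt0 chi' eta_gt0 L0
  loss_le lin' (fdro_min w).
move=> /le_trans; apply; rewrite lee_fin mulrDr lerD2r ler_wpM2l//.
by rewrite /eta sqrtrM ?invr_ge0// sqrtrV.
Qed.
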